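(* Assume the Uniformity Conjecture is true. Let $q(x,y,z)\in\mathbb{Q}[x,y,z]$ and $p(x,y)\in\mathbb{Q}[x,y]$, and let $F(x,y,z)=q(x,y,z)^2-p(x,y)$ be a polynomial of degree $d$ with $\frac{\partial F}{\partial z}\neq 0$ (not identically zero). Let $d_p:=\deg_y(p)\geq 1$, and let $s$ be the smallest integer such that $s d_p\geq 5$. Let $A,B,C\subseteq\mathbb{Q}$ be finite sets, and assume that for every $a\in A$ the univariate polynomial $p(a,y)$ has no repeated roots. Then \[ |Z(F)\cap (A\times B\times C)| \ll_{s,d} |A||B|^{1-1/s}+|A|^{1-1/s}|B|+|M_{A,p}|^{1/s}|B|+L_F|C|, \] where \[ M_{A,p}:=\{(a_1,\dots,a_s)\in A^s : \text{the } a_i \text{ are distinct and there exist } i\neq j \text{ such that } p(a_i,y) \text{ and } p(a_j,y) \text{ have a common root in } \mathbb{C}\} \] and \[ L_F:=|\{(a,b)\in A\times B : F(a,b,z)\equiv 0 \text{ as a polynomial in } z\}|. \]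
   Context: Uniformity Conjecture (over $\mathbb{Q}$): for every integer $g\geq 2$ there exists an integer $B_g$ such that every smooth curve of genus $g$ defined over $\mathbb{Q}$ has at most $B_g$ rational points. $Z(F)$ denotes the (real) zero set of $F$. The notation $X\ll_{a} Y$ means $X\leq cY$ for a constant $c>0$ depending only on $a$ (the constants $B_g$ being regarded as fixed absolute constants). *)

(* Defs.v *)
From HB Require Import structures.
From mathcomp Require Import all_boot all_order all_algebra all_field finmap.
From mathcomp Require Import boolp classical_sets reals exp.
From mathcomp Require Import complex mpoly.

Set Implicit Arguments.
Unset Strict Implicit.
Unset Printing Implicit Defensive.

Import Order.TTheory GRing.Theory Num.Theory.

Local Open Scope classical_set_scope.
Local Open Scope ring_scope.

(* A projective scheme in P^n over rat is given by a list gs of homogeneous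
   polynomials in n + 1 variables. By the Hilbert basis theorem, every closed
   subscheme of P^n arises in this way; every smooth projective curve embeds
   in some P^n. *)

Definition gen_ideal (K : fieldType) (n : nat) (gs : seq {mpoly K[n]}) :
    set {mpoly K[n]} :=
  [set f | exists h : 'I_(size gs) -> {mpoly K[n]}, f = \sum_i h i * gs`_i].

Definition prime_ideal (K : fieldType) (n : nat) (I : set {mpoly K[n]}) : Prop :=
  ~ I 1 /\ forall f g, I (f * g) -> I f \/ I g.

(* algC is an algebraic closure of rat. *)
Definition base_change (n : nat) (gs : seq {mpoly rat[n]}) :
    seq {mpoly algC[n]} :=
  [seq map_mpoly ratr g | g <- gs].

Definition proj_zero (K : fieldType) (n : nat) (gs : seq {mpoly K[n.+1]})
    (x : 'rV[K]_n.+1) : Prop :=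
  x != 0 /\ forall g, g \in gs -> g.@[x ord0] = 0.

(* Jacobian criterion for smoothness of relative dimension 1: at every
   geometric point the Jacobian matrix has rank n - 1. *)
Definition smooth_dim1 (n : nat) (gs : seq {mpoly rat[n.+1]}) : Prop :=
  let gsC := base_change gs in
  forall x : 'rV[algC]_n.+1, proj_zero gsC x ->
    (\rank (\matrix_(i < size gsC, j < n.+1) ((gsC`_i)^`M(j)).@[x ord0])).+1 = n.

(* hilbert_value gs k N: the degree k component of rat[x_0, ..., x_n] / (gs)
   has dimension N over rat. *)
Definition hilbert_value (n : nat) (gs : seq {mpoly rat[n.+1]}) (k N : nat) :
    Prop :=
  exists V : {vspace dhomog n.+1 rat k},
    (forall f, f \in V <-> gen_ideal gs (mpoly_of_dhomog f)) /\
    \dim {: dhomog n.+1 rat k} = (\dim V + N)%N.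

(* The Hilbert polynomial is e * k + (1 - g), so that the dimension is 1 and
   the arithmetic genus, which for a smooth projective curve is the genus,
   is g. *)
Definition dim1_genus (n : nat) (gs : seq {mpoly rat[n.+1]}) (g : nat) : Prop :=
  exists2 e : nat, (0 < e)%N & exists k0 : nat, forall k, (k0 <= k)%N ->
    exists2 N : nat, hilbert_value gs k N & (N + g = e * k + 1)%N.

Definition smooth_curve (n : nat) (gs : seq {mpoly rat[n.+1]}) (g : nat) : Prop :=
  [/\ forall f, f \in gs -> exists k, f \is k.-homog,
      prime_ideal (gen_ideal (base_change gs)),
      smooth_dim1 gs
    & dim1_genus gs g].

(* A point of P^n(rat) is a line of rat^(n+1), given by a spanning vector; two
   vectors u, v give the same point iff (u == v)%MS. *)
Definition at_most_rational_points (n : nat) (gs : seq {mpoly rat[n.+1]})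
    (B : nat) : Prop :=
  forall ps : seq 'rV[rat]_n.+1,
    (forall x, x \in ps -> proj_zero gs x) ->
    pairwise (fun u v : 'rV[rat]_n.+1 => ~~ (u == v)%MS) ps ->
    (size ps <= B)%N.

Definition uniformity_conjecture : Prop :=
  forall g : nat, (2 <= g)%N -> exists B : nat,
    forall (n : nat) (gs : seq {mpoly rat[n.+1]}),
      smooth_curve gs g -> at_most_rational_points gs B.

Definition zero_set (R : realType) (n : nat) (F : {mpoly rat[n]}) :
    set (n.-tuple R) :=
  [set v | (map_mpoly ratr F).@[tnth v] = 0].

Definition subst_poly (n : nat) (F : {mpoly rat[n]}) (v : n.-tuple {poly rat}) :
    {poly rat} :=
  mmap (@polyC rat) (tnth v) F.

Definition deg_y (p : {mpoly rat[2]}) : nat :=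
  \max_(m <- msupp p) m (ord_max : 'I_2).

Definition at_x (p : {mpoly rat[2]}) (a : rat) : {poly rat} :=
  subst_poly p [tuple a%:P; 'X].

Definition at_xy (F : {mpoly rat[3]}) (a b : rat) : {poly rat} :=
  subst_poly F [tuple a%:P; b%:P; 'X].

(* The zero polynomial has repeated roots in this sense. *)
Definition no_repeated_roots (R : realType) (f : {poly rat}) : Prop :=
  forall z : R[i], ~~ (('X - z%:P) ^+ 2 %| map_poly ratr f).

Definition common_root (R : realType) (f g : {poly rat}) : Prop :=
  exists z : R[i], root (map_poly ratr f) z /\ root (map_poly ratr g) z.

Local Open Scope fset_scope.

Definition bad_tuples (R : realType) (A : {fset rat}) (p : {mpoly rat[2]})
    (s : nat) : {set s.-tuple A} :=
  [set t : s.-tuple A | uniq t &&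
    `[< exists i j : 'I_s, i != j /\
          common_root R (at_x p (val (tnth t i))) (at_x p (val (tnth t j))) >]].

Definition vertical_pairs (A B : {fset rat}) (F : {mpoly rat[3]}) :
    {fset rat * rat} :=
  [fset ab in A `*` B | at_xy F ab.1 ab.2 == 0].

Definition zeros_on_grid (R : realType) (A B C : {fset rat})
    (F : {mpoly rat[3]}) : {fset rat * rat * rat} :=
  [fset abc in A `*` B `*` C |
    [tuple ratr abc.1.1; ratr abc.1.2; ratr abc.2] \in @zero_set R _ F].

(* Main.v *)
(* If F(a, b, c) = 0 then p(a, b) is a rational square, and away from the
   vertical pairs each such (a, b) comes with at most d values of c; so it is
   enough to count the pairs (a, b) for which p(a, b) is a square. Let x_b be
   the number of a paired in this way with b. For a tuple of s distinct a_i
   outside the bad set, f(y) = p(a_1, y) ... p(a_s, y) is squarefree of degree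
   s d_p >= 5 (discarding the at most 2 d + 1 values of a at which the degree of
   p(a, y) drops), and every b paired with all the a_i is the abscissa of a
   rational point of the curve w^2 = f(y), of genus g >= 2. Uniformity bounds
   the number of such b, whence sum_b x_b (x_b - 1) ... (x_b - s + 1) is
   O(|A|^s + |M| |B|), and a power-mean argument bounds sum_b x_b.

   The smooth projective model of w^2 = f(y) is the intersection, in P^(g + 2),
   of the cone over the rational normal curve of degree G = g + 1 with one
   quadric. Its homogeneous coordinate ring in degree k is
   K[y]_(<= k G) + w K[y]_(<= (k - 1) G), of dimension 2 G k + 1 - g. *)

Require Import Defs.
From HB Require Import structures.
From mathcomp Require Import all_boot all_order all_algebra all_field finmap.
From mathcomp Require Import boolp classical_sets reals exp.
From mathcomp Require Import complex mpoly.
From mathcomp Require Import zify ring lra.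

Set Implicit Arguments.
Unset Strict Implicit.
Unset Printing Implicit Defensive.

Import Order.TTheory GRing.Theory Num.Theory.

Local Open Scope ring_scope.

(** * Quadratic extensions and generated ideals *)

(* [Quad a b] stands for [a + b * sqrt c]. *)
Record quad (R : comNzRingType) (c : R) := Quad { rpart : R; ipart : R }.

Arguments Quad {R c}.

Section QuadraticExtension.
Variables (R : comNzRingType) (c : R).

Local Notation quad := (quad c).

Definition pair_of_quad (z : quad) := (rpart z, ipart z).
Definition quad_of_pair (z : R * R) : quad := Quad z.1 z.2.
Lemma pair_of_quadK : cancel pair_of_quad quad_of_pair.
Proof. by case. Qed.

HB.instance Definition _ := Choice.copy quad (can_type pair_of_quadK).

Definition addq (y z : quad) : quad :=
  Quad (rpart y + rpart z) (ipart y + ipart z).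
Definition oppq (z : quad) : quad := Quad (- rpart z) (- ipart z).
Definition mulq (y z : quad) : quad :=
  Quad (rpart y * rpart z + c * (ipart y * ipart z))
       (rpart y * ipart z + ipart y * rpart z).

Lemma quadP (y z : quad) : rpart y = rpart z -> ipart y = ipart z -> y = z.
Proof. by case: y z => [a b] [a' b'] /= -> ->. Qed.

Lemma addqA : associative addq.
Proof. by move=> x y z; apply: quadP; rewrite /= addrA. Qed.
Lemma addqC : commutative addq.
Proof. by move=> x y; apply: quadP; rewrite /= addrC. Qed.
Lemma add0q : left_id (Quad 0 0) addq.
Proof. by move=> x; apply: quadP; rewrite /= add0r. Qed.
Lemma addNq : left_inverse (Quad 0 0) oppq addq.
Proof. by move=> x; apply: quadP; rewrite /= addNr. Qed.

HB.instance Definition _ :=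
  GRing.isZmodule.Build quad addqA addqC add0q addNq.

Lemma mulqA : associative mulq.
Proof. by move=> x y z; apply: quadP => /=; ring. Qed.
Lemma mulqC : commutative mulq.
Proof. by move=> x y; apply: quadP => /=; ring. Qed.
Lemma mul1q : left_id (Quad 1 0) mulq.
Proof. by move=> x; apply: quadP => /=; ring. Qed.
Lemma mulqDl : left_distributive mulq +%R.
Proof. by move=> x y z; apply: quadP => /=; ring. Qed.
Lemma oneq_neq0 : Quad 1 0 != 0 :> quad.
Proof. by apply/eqP => -[] /eqP; rewrite oner_eq0. Qed.

HB.instance Definition _ :=
  GRing.Zmodule_isComNzRing.Build quad mulqA mulqC mul1q mulqDl oneq_neq0.

Definition quadC (a : R) : quad := Quad a 0.

Lemma rpart_is_zmod_morphism : zmod_morphism (@rpart R c). Proof. by []. Qed.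
Lemma ipart_is_zmod_morphism : zmod_morphism (@ipart R c). Proof. by []. Qed.
Lemma quadC_is_zmod_morphism : zmod_morphism quadC.
Proof. by move=> x y; apply: quadP; rewrite /= ?subrr. Qed.
Lemma quadC_is_monoid_morphism : monoid_morphism quadC.
Proof. by split=> // x y; apply: quadP => /=; ring. Qed.

HB.instance Definition _ := GRing.isZmodMorphism.Build quad R (@rpart R c)
  rpart_is_zmod_morphism.
HB.instance Definition _ := GRing.isZmodMorphism.Build quad R (@ipart R c)
  ipart_is_zmod_morphism.
HB.instance Definition _ := GRing.isZmodMorphism.Build R quad quadC
  quadC_is_zmod_morphism.
HB.instance Definition _ := GRing.isMonoidMorphism.Build R quad quadC
  quadC_is_monoid_morphism.

End QuadraticExtension.

Arguments quadC {R c}.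

Lemma rpartM (R : comNzRingType) (c : R) (y z : quad c) :
  rpart (y * z) = rpart y * rpart z + c * (ipart y * ipart z).
Proof. by []. Qed.

Lemma ipartM (R : comNzRingType) (c : R) (y z : quad c) :
  ipart (y * z) = rpart y * ipart z + ipart y * rpart z.
Proof. by []. Qed.

(* The norm [a ^ 2 - c * b ^ 2] is multiplicative and, by [nsq], vanishes only
   at zero. *)
Lemma quad_mulf_eq0 (R : idomainType) (c : R)
    (nsq : forall a b : R, a ^+ 2 = c * b ^+ 2 -> a = 0 /\ b = 0)
    (y z : quad c) :
  y * z = 0 -> y = 0 \/ z = 0.
Proof.
pose N (u : quad c) : R := rpart u ^+ 2 - c * ipart u ^+ 2.
have NM u v : N (u * v) = N u * N v.
  by rewrite /N rpartM ipartM; ring.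
have N0 u : N u = 0 -> u = 0.
  by move/eqP; rewrite subr_eq0 => /eqP/nsq[a0 b0]; apply: quadP.
move=> yz0; have := NM y z; rewrite yz0 /N /= !expr0n /= mulr0 subr0.
move/esym/eqP; rewrite mulf_eq0 => /orP[] /eqP.
  by move/N0; left.
by move/N0; right.
Qed.

Section GeneratedIdeal.
Variables (K : fieldType) (n : nat) (gs : seq {mpoly K[n]}).

Lemma gen_idealD f g : gen_ideal gs f -> gen_ideal gs g -> gen_ideal gs (f + g).
Proof.
move=> [h ->] [h' ->]; exists (fun i => h i + h' i).
by rewrite -big_split; apply: eq_bigr => i _; rewrite mulrDl.
Qed.

Lemma gen_idealMl f g : gen_ideal gs g -> gen_ideal gs (f * g).
Proof.
move=> [h ->]; exists (fun i => f * h i).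
by rewrite mulr_sumr; apply: eq_bigr => i _; rewrite mulrA.
Qed.

Lemma gen_idealZ a f : gen_ideal gs f -> gen_ideal gs (a *: f).
Proof. by rewrite -mul_mpolyC; apply: gen_idealMl. Qed.

Lemma gen_ideal0 : gen_ideal gs 0.
Proof. by exists (fun=> 0); rewrite big1 // => i _; rewrite mul0r. Qed.

Lemma gen_ideal_eq f g : gen_ideal gs f -> g = f -> gen_ideal gs g.
Proof. by move=> If ->. Qed.

Lemma gen_ideal_sum (I : Type) (r : seq I) (P : pred I)
    (F : I -> {mpoly K[n]}) :
  (forall i, P i -> gen_ideal gs (F i)) ->
  gen_ideal gs (\sum_(i <- r | P i) F i).
Proof.
move=> IF; elim/big_rec: _ => [|i f Pi If]; first exact: gen_ideal0.
by apply: gen_idealD => //; apply: IF.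
Qed.

Lemma mem_gen_ideal g : g \in gs -> gen_ideal gs g.
Proof.
move=> gs_g; have lt_i : (index g gs < size gs)%N by rewrite index_mem.
exists (fun i => (i == Ordinal lt_i)%:R).
rewrite (bigD1 (Ordinal lt_i)) //= eqxx mul1r nth_index //.
by rewrite big1 ?addr0 // => i /negPf->; rewrite mul0r.
Qed.

Lemma gen_ideal_ind (P : {mpoly K[n]} -> Prop) :
  P 0 -> (forall f g, P f -> P g -> P (f + g)) ->
  (forall h g, g \in gs -> P (h * g)) ->
  forall f, gen_ideal gs f -> P f.
Proof.
move=> P0 PD PM f [h ->]; elim/big_rec: _ => // i g _ Pg.
by apply: PD => //; apply: PM; apply: mem_nth.
Qed.

End GeneratedIdeal.

(** * A projective model of a hyperelliptic curve *)

Lemma poly_sum_Xn (K : nzRingType) m (a : {poly K}) : (size a <= m)%N ->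
  a = \sum_(t < m) a`_t *: 'X^t.
Proof.
move=> le_a; rewrite -poly_def; apply/polyP => i; rewrite coef_poly.
by case: ltnP => // le_i; rewrite nth_default // (leq_trans le_a).
Qed.

Section HyperellipticModel.
Variables (K : fieldType) (G : nat) (f : {poly K}).

Definition uvar (i : nat) : {mpoly K[G.+2]} := 'X_(inord i).
Definition wvar : {mpoly K[G.+2]} := 'X_ord_max.

(** A chosen quadratic monomial standing for [x ^ k], [k <= 2 G], under [u_i = x ^ i]; the other
    products of two [u]'s with index sum [k] are compared with it. *)
Definition umon (k : nat) : {mpoly K[G.+2]} :=
  if (k <= G)%N then uvar 0 * uvar k else uvar G * uvar (k - G).

(** The right-hand side [f x] as a quadratic form on the rational normal curve, for [f] of degree at
    most [2 G]. *)
Definition uform : {mpoly K[G.+2]} := \sum_(k < G.*2.+1) f`_k *: umon k.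

(** Each 2 x 2 minor [u_i u_j - u_i' u_j'] with [i + j = i' + j'] is a difference of two of these,
    so they cut out the rational normal curve. *)
Definition scroll (i j : nat) : {mpoly K[G.+2]} :=
  uvar i * uvar j - umon (i + j).

(* The image of [w ^ 2 = f x] under [(u_0 : ... : u_G : w) = (1 : x : ... :
   x ^ G : w)]: the cone over the rational normal curve of degree [G], cut by a
   quadric. *)
Definition hypell : seq {mpoly K[G.+2]} :=
  (wvar ^+ 2 - uform)
    :: [seq scroll i j | i <- iota 0 G.+1, j <- iota 0 G.+1].

Lemma hypellP (g : {mpoly K[G.+2]}) :
  g \in hypell <-> g = wvar ^+ 2 - uform \/
    exists i j, [/\ (i <= G)%N, (j <= G)%N & g = scroll i j].
Proof.
rewrite inE; split.
  case/orP=> [/eqP->|]; first by left.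
  case/allpairsP=> -[i j] []; rewrite !mem_iota !add0n !ltnS => le_i le_j ->.
  by right; exists i, j.
case=> [->|[i [j [le_i le_j ->]]]]; first by rewrite eqxx.
by apply/orP; right; apply: allpairs_f; rewrite mem_iota add0n ltnS.
Qed.

Lemma gen_hypell_w : gen_ideal hypell (wvar ^+ 2 - uform).
Proof. by apply/mem_gen_ideal/hypellP; left. Qed.

Lemma gen_hypell_scroll i j : (i <= G)%N -> (j <= G)%N ->
  gen_ideal hypell (scroll i j).
Proof.
by move=> le_i le_j; apply/mem_gen_ideal/hypellP; right; exists i, j.
Qed.

Lemma homog_uvar i : uvar i \is 1.-homog.
Proof. by rewrite dhomogX; apply/eqP; apply: mdeg1. Qed.

Lemma homog_wvar : wvar \is 1.-homog.
Proof. by rewrite dhomogX; apply/eqP; apply: mdeg1. Qed.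

Lemma homog_umon k : umon k \is 2.-homog.
Proof.
rewrite /umon; case: ifP => _; apply: (@dhomogM _ _ _ 1 _ 1);
  exact: homog_uvar.
Qed.

Lemma hypell_homog g : g \in hypell -> g \is 2.-homog.
Proof.
case/hypellP=> [->|[i [j [_ _ ->]]]]; apply: rpredB.
- exact: (@dhomogMn _ _ _ 1 _ 2 homog_wvar).
- by apply: rpred_sum => k _; apply: dhomogZ; apply: homog_umon.
- by apply: (@dhomogM _ _ _ 1 _ 1); apply: homog_uvar.
- exact: homog_umon.
Qed.

(* The coordinate ring embeds in [K[x, t][w] / (w ^ 2 - t ^ 2 f x)], where [t]
   keeps track of the degree. *)
Let R : comNzRingType := {poly {poly K}}.
Let c : R := f%:P * 'X^2.

Definition mono (k i : nat) : R := ('X^i)%:P * 'X^k.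

Lemma monoM k i k' i' : mono k i * mono k' i' = mono (k + k') (i + i').
Proof. by rewrite /mono !exprD polyCM; ring. Qed.

Definition phi : {mpoly K[G.+2]} -> quad c :=
  mmap (quadC \o polyC \o polyC)
    (fun j : 'I_G.+2 => if j == ord_max then Quad 0 1 else quadC (mono 1 j)).

HB.instance Definition _ := GRing.RMorphism.copy phi phi.

Lemma phi0 : phi 0 = 0. Proof. exact: rmorph0. Qed.
Lemma phi1 : phi 1 = 1. Proof. exact: rmorph1. Qed.
Lemma phiB F H : phi (F - H) = phi F - phi H. Proof. exact: rmorphB. Qed.
Lemma phiD F H : phi (F + H) = phi F + phi H. Proof. exact: rmorphD. Qed.
Lemma phiM F H : phi (F * H) = phi F * phi H. Proof. exact: rmorphM. Qed.
Lemma phiX F m : phi (F ^+ m) = phi F ^+ m. Proof. exact: rmorphXn. Qed.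
Lemma phi_sum (I : Type) (r : seq I) (P : pred I) (F : I -> {mpoly K[G.+2]}) :
  phi (\sum_(i <- r | P i) F i) = \sum_(i <- r | P i) phi (F i).
Proof. exact: rmorph_sum. Qed.

Lemma phiZ a F : phi (a *: F) = quadC a%:P%:P * phi F.
Proof. exact: mmapZ. Qed.

Lemma phi_uvar i : (i <= G)%N -> phi (uvar i) = quadC (mono 1 i).
Proof.
move=> le_i; rewrite /phi mmapX mmap1U ifF ?inordK //; first exact: leqW.
by apply/eqP=> /(congr1 val) /=; rewrite inordK ?ltnS; lia.
Qed.

Lemma phi_wvar : phi wvar = Quad 0 1.
Proof. by rewrite /phi mmapX mmap1U eqxx. Qed.

Lemma phi_umon k : (k <= G.*2)%N -> phi (umon k) = quadC (mono 2 k).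
Proof.
move=> le_k; rewrite /umon; case: leqP => [le_kG|lt_Gk].
  by rewrite phiM !phi_uvar // -rmorphM monoM add0n.
rewrite phiM !phi_uvar //; last lia.
by rewrite -rmorphM monoM subnKC // ltnW.
Qed.

Hypothesis size_f : (size f <= G.*2.+1)%N.

Lemma phi_uform : phi uform = quadC c.
Proof.
rewrite phi_sum (eq_bigr (fun k : 'I_G.*2.+1 =>
  quadC ((f`_k)%:P%:P * mono 2 k))); last first.
  by move=> k _; rewrite phiZ phi_umon -?rmorphM // -ltnS.
rewrite -rmorph_sum /c; congr quadC.
transitivity ((\sum_(k < G.*2.+1) f`_k *: 'X^k)%:P * 'X^2 : R).
  rewrite rmorph_sum mulr_suml; apply: eq_bigr => k _.
  by rewrite /= /mono mulrA -polyCM -mul_polyC.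
by rewrite -poly_sum_Xn.
Qed.

Lemma phi_hypell F : gen_ideal hypell F -> phi F = 0.
Proof.
move: F; apply: gen_ideal_ind => [|F H F0 H0|h g hyp_g]; first exact: phi0.
  by rewrite phiD F0 H0 addr0.
rewrite phiM; suff ->: phi g = 0 by rewrite mulr0.
case/hypellP: hyp_g => [->|[i [j [le_i le_j ->]]]].
  rewrite phiB phiX phi_wvar phi_uform; apply: quadP.
    by rewrite /=; ring.
  by rewrite /=; ring.
rewrite phiB phiM !phi_uvar // -rmorphM monoM phi_umon ?subrr //.
lia.
Qed.

(* A monomial of degree [k] mapped to [x ^ t] by [phi]; only meaningful for
   [t <= k * G]. *)
Fixpoint nmon (k t : nat) : {mpoly K[G.+2]} :=
  if k is k'.+1 then
    if (t <= G)%N then uvar t * uvar 0 ^+ k' else uvar G * nmon k' (t - G)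
  else 1.

Lemma homog_nmon k t : nmon k t \is k.-homog.
Proof.
elim: k t => [|k IHk] t /=; first exact: dhomog1.
case: leqP => _; apply: (@dhomogM _ _ _ 1 _ k); rewrite ?homog_uvar ?IHk //.
by have := @dhomogMn _ _ _ 1 _ k (homog_uvar 0); rewrite mul1n.
Qed.

Lemma phi_nmon k t : (t <= k * G)%N -> phi (nmon k t) = quadC (mono k t).
Proof.
elim: k t => [|k IHk] t /=.
  by rewrite mul0n leqn0 => /eqP->; rewrite phi1 /mono !expr0 mulr1.
move=> le_t; case: leqP => [le_tG|lt_Gt].
  rewrite phiM phiX !phi_uvar //=.
  have ->: quadC (mono 1 0) ^+ k = quadC (mono k 0) :> quad c.
    rewrite -rmorphXn /=; congr quadC; elim: (k) => [|m IHm].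
      by rewrite /mono mulr1.
    by rewrite exprS IHm monoM add1n.
  by rewrite -rmorphM monoM addn0.
rewrite phiM phi_uvar // IHk ?leq_subLR -?mulSn // -rmorphM monoM.
by rewrite subnKC // ltnW.
Qed.

(** Straightening. For [t <= G] a scroll relation rewrites [u_i u_t]; for larger [t] both monomials
    contain [u_G], and the induction hypothesis applies to the cofactors. *)
Lemma uvar_nmon k t i : (t <= k * G)%N -> (i <= G)%N ->
  gen_ideal hypell (uvar i * nmon k t - nmon k.+1 (i + t)).
Proof.
elim: k t => [|k IHk] t.
  rewrite mul0n leqn0 => /eqP-> le_i /=; rewrite addn0 le_i subrr.
  exact: gen_ideal0.
move=> le_t le_i; case: (leqP t G) => [le_tG|lt_Gt].
  have /(gen_idealMl (uvar 0 ^+ k)) := gen_hypell_scroll le_i le_tG.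
  rewrite /scroll /umon /= le_tG; case: leqP => [le_itG|lt_itG] I_s.
    by apply: (gen_ideal_eq I_s); rewrite exprS; ring.
  rewrite ifT; last lia.
  by apply: (gen_ideal_eq I_s); ring.
have le_tG : (t - G <= k * G)%N by rewrite leq_subLR -mulSn.
have I_s := gen_idealMl (uvar G) (IHk _ le_tG le_i); apply: (gen_ideal_eq I_s).
have -> : nmon k.+1 t = uvar G * nmon k (t - G) by rewrite /= leqNgt lt_Gt.
have -> : nmon k.+2 (i + t) = uvar G * nmon k.+1 (i + (t - G)).
  rewrite addnBA; last exact: ltnW.
  by rewrite [LHS]/= leqNgt (leq_trans lt_Gt) ?leq_addl.
by ring.
Qed.

(** A section of [phi] on the part without [w]: it lifts [a(x) t ^ k] to a form of degree [k],
    provided that [a] has degree at most [k G]. *)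
Definition sigma (k : nat) (a : {poly K}) : {mpoly K[G.+2]} :=
  \sum_(t < (k * G).+1) a`_t *: nmon k t.

Lemma homog_sigma k a : sigma k a \is k.-homog.
Proof. by apply: rpred_sum => t _; apply: dhomogZ; apply: homog_nmon. Qed.

Lemma sigmaD k a b : sigma k (a + b) = sigma k a + sigma k b.
Proof. by rewrite -big_split; apply: eq_bigr => t _; rewrite coefD scalerDl. Qed.

Lemma sigmaZ k x a : sigma k (x *: a) = x *: sigma k a.
Proof. by rewrite scaler_sumr; apply: eq_bigr => t _; rewrite coefZ scalerA. Qed.

Lemma sigma_Xn k t : (t <= k * G)%N -> sigma k 'X^t = nmon k t.
Proof.
rewrite -ltnS => lt_t; rewrite /sigma (bigD1 (Ordinal lt_t)) //=.
rewrite coefXn eqxx scale1r.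
rewrite big1 ?addr0 // => j; rewrite -val_eqE /= coefXn => /negPf->.
by rewrite scale0r.
Qed.

Lemma sigma0 k : sigma k 0 = 0.
Proof. by rewrite /sigma big1 // => t _; rewrite coef0 scale0r. Qed.

Lemma sigma_sum k m (b : nat -> K) (e : nat -> nat) :
  (forall t, (t < m)%N -> (e t <= k * G)%N) ->
  sigma k (\sum_(t < m) b t *: 'X^(e t)) = \sum_(t < m) b t *: nmon k (e t).
Proof.
elim: m => [|m IHm] le_e; first by rewrite !big_ord0 sigma0.
rewrite !big_ord_recr /= sigmaD sigmaZ sigma_Xn; last exact: le_e.
by rewrite IHm // => t lt_t; apply: le_e; apply: ltnW.
Qed.

Lemma uvar_sigma k (a : {poly K}) i : (size a <= (k * G).+1)%N -> (i <= G)%N ->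
  gen_ideal hypell (uvar i * sigma k a - sigma k.+1 ('X^i * a)).
Proof.
move=> le_a le_i.
have ->: 'X^i * a = \sum_(t < (k * G).+1) a`_t *: 'X^(i + t).
  rewrite {1}(poly_sum_Xn le_a) mulr_sumr; apply: eq_bigr => t _.
  by rewrite -scalerAr exprD.
rewrite (@sigma_sum _ _ _ (addn i)); last by move=> t lt_t; rewrite mulSn leq_add.
rewrite /sigma mulr_sumr -sumrB; apply: gen_ideal_sum => t _.
rewrite -scalerAr -scalerBr; apply/gen_idealZ/uvar_nmon => //.
by rewrite -ltnS.
Qed.

Lemma phi_sigma k (a : {poly K}) : (size a <= (k * G).+1)%N ->
  phi (sigma k a) = quadC (a%:P * 'X^k).
Proof.
move=> le_a; rewrite [in RHS](poly_sum_Xn le_a) /sigma phi_sum rmorph_sum /=.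
rewrite mulr_suml [RHS]rmorph_sum; apply: eq_bigr => t _.
rewrite phiZ phi_nmon; last by rewrite -ltnS.
by rewrite -rmorphM /= /mono mulrA -polyCM -mul_polyC.
Qed.

(** * Normal forms modulo the ideal of the model *)

Definition unormal (k : nat) (F : {mpoly K[G.+2]}) : Prop :=
  exists2 a : {poly K}, (size a <= (k * G).+1)%N &
    gen_ideal hypell (F - sigma k a).

Lemma unormalD k F H : unormal k F -> unormal k H -> unormal k (F + H).
Proof.
move=> [a le_a IF] [b le_b IH]; exists (a + b).
  by rewrite (leq_trans (size_polyD _ _)) // geq_max le_a.
by rewrite sigmaD opprD addrACA; apply: gen_idealD.
Qed.

Lemma unormalZ k x F : unormal k F -> unormal k (x *: F).
Proof.
move=> [a le_a IF]; exists (x *: a); first exact: leq_trans (size_scale_leq _ _) _.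
by rewrite sigmaZ -scalerBr; apply: gen_idealZ.
Qed.

Lemma unormal0 k : unormal k 0.
Proof.
by exists 0; rewrite ?size_poly0 // sigma0 subrr; apply: gen_ideal0.
Qed.

Lemma unormal_uvar k i F : (i <= G)%N -> unormal k F -> unormal k.+1 (uvar i * F).
Proof.
move=> le_i [a le_a IF]; exists ('X^i * a).
  rewrite (leq_trans (size_polyMleq _ _)) // size_polyXn addSn /=.
  by rewrite mulSn -addnS leq_add.
have := gen_idealD (gen_idealMl (uvar i) IF) (uvar_sigma le_a le_i).
by rewrite mulrBr addrA subrK.
Qed.

Lemma unormal_uform k F : unormal k F -> unormal k.+2 (uform * F).
Proof.
move=> nF; rewrite /uform mulr_suml.
apply: (big_ind (unormal k.+2)) => [||j _]; [exact: unormal0|exact: unormalD|].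
rewrite -scalerAl; apply: unormalZ; rewrite /umon.
case: leqP => lt_j; rewrite -mulrA; do 2! [apply: unormal_uvar => //].
have := ltn_ord j; lia.
Qed.

(** As [w] has degree one, its cofactor lives in degree [k - 1] and must vanish when [k = 0]. *)
Definition normal (k : nat) (F : {mpoly K[G.+2]}) : Prop :=
  exists F0 F1, [/\ unormal k F0, if k is k'.+1 then unormal k' F1 else F1 = 0
    & gen_ideal hypell (F - (F0 + wvar * F1))].

Lemma normalD k F H : normal k F -> normal k H -> normal k (F + H).
Proof.
move=> [F0 [F1 [nF0 nF1 IF]]] [H0 [H1 [nH0 nH1 IH]]].
exists (F0 + H0), (F1 + H1); split; first exact: unormalD.
  by case: k nF1 nH1 {nF0 nH0} => [-> ->|k]; [rewrite addr0|apply: unormalD].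
by apply: (gen_ideal_eq (gen_idealD IF IH)); ring.
Qed.

Lemma normalZ k x F : normal k F -> normal k (x *: F).
Proof.
move=> [F0 [F1 [nF0 nF1 IF]]]; exists (x *: F0), (x *: F1); split.
- exact: unormalZ.
- by case: k nF1 {nF0} => [->|k]; [rewrite scaler0|apply: unormalZ].
- by rewrite -scalerAr -scalerDr -scalerBr; apply: gen_idealZ.
Qed.

Lemma normal0 k : normal k 0.
Proof.
exists 0, 0; split; first exact: unormal0.
  by case: k => // k; apply: unormal0.
by rewrite mulr0 addr0 subrr; apply: gen_ideal0.
Qed.

Lemma normal_uvar k i F : (i <= G)%N -> normal k F -> normal k.+1 (uvar i * F).
Proof.
move=> le_i [F0 [F1 [nF0 nF1 IF]]]; exists (uvar i * F0), (uvar i * F1); split.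
- exact: unormal_uvar.
- case: k nF1 {nF0} => [->|k]; last exact: unormal_uvar.
  by rewrite mulr0; apply: unormal0.
- by apply: (gen_ideal_eq (gen_idealMl (uvar i) IF)); ring.
Qed.

(** Multiplication by [w] swaps the two components: [w (F0 + w F1)] is [uform F1 + w F0] modulo the
    quadric. *)
Lemma normal_wvar k F : normal k F -> normal k.+1 (wvar * F).
Proof.
move=> [F0 [F1 [nF0 nF1 IF]]]; exists (uform * F1), F0; split=> //.
  case: k nF1 {nF0} => [->|k]; last exact: unormal_uform.
  by rewrite mulr0; apply: unormal0.
have I_F := gen_idealD (gen_idealMl wvar IF) (gen_idealMl F1 gen_hypell_w).
by apply: (gen_ideal_eq I_F); ring.
Qed.

(** Strong induction on the degree, peeling off one variable that divides the monomial. *)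
Lemma normal_X (m : 'X_{1..G.+2}) : normal (mdeg m) 'X_[m].
Proof.
have [N] := ubnP (mdeg m); elim: N m => // N IHN m; rewrite ltnS => le_m.
have [m0|m_neq0] := eqVneq (mdeg m) 0%N.
  move/eqP: (m0); rewrite mdeg_eq0 => /eqP->; rewrite mdeg0 mpolyX0.
  exists 1, 0; split=> //; last first.
    by rewrite mulr0 addr0 subrr; apply: gen_ideal0.
  exists 1; first by rewrite size_poly1.
  have /= := sigma_Xn (leq0n (0 * G)).
  by rewrite expr0 => ->; rewrite subrr; apply: gen_ideal0.
have [j mj] : exists j, m j != 0%N.
  apply/existsP; rewrite -negb_forall; apply: contraNN m_neq0 => /forallP m0.
  by rewrite mdegE big1 // => j _; apply/eqP.
have le_jm : (U_(j) <= m)%MM by rewrite lep1mP.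
rewrite -(submK le_jm) mpolyXD mulrC mdegD mdeg1 addn1.
have nm : normal (mdeg (m - U_(j))%MM) 'X_[m - U_(j)].
  apply: IHN; have := mdegD (m - U_(j))%MM U_(j)%MM.
  by rewrite submK // mdeg1 addn1 => E; rewrite E in le_m.
move: (m - U_(j))%MM nm => m' nm.
have [->|neq_j] := eqVneq j ord_max; first exact: normal_wvar.
have lt_j : (j < G.+1)%N.
  by have := ltn_ord j; move: neq_j; rewrite -val_eqE /=; lia.
rewrite -[j]inord_val -/(uvar j); exact: normal_uvar.
Qed.

Lemma normal_homog k F : F \is k.-homog -> normal k F.
Proof.
move=> /dhomogP hF; rewrite [F]mpolyE big_seq.
apply: (big_ind (normal k)) => [||m /hF <-]; [exact: normal0|exact: normalD|].
by apply/normalZ/normal_X.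
Qed.

(* [phi F] determines [a] and [b], and [a = b = 0] forces [F] into the ideal. *)
Lemma normal_form k F : F \is k.-homog ->
  exists a b : {poly K}, [/\ (size a <= (k * G).+1)%N,
    (size b <= (k.-1 * G).+1)%N,
    k = 0%N -> b = 0, gen_ideal hypell (F - (sigma k a + wvar * sigma k.-1 b))
    & phi F = Quad (a%:P * 'X^k) (b%:P * 'X^(k.-1))].
Proof.
move=> /normal_homog[F0 [F1 [[a le_a Ia] nF1 IF]]].
have [b [le_b b0 Ib]] : exists b : {poly K}, [/\ (size b <= (k.-1 * G).+1)%N,
    k = 0%N -> b = 0 & gen_ideal hypell (F1 - sigma k.-1 b)].
  case: k nF1 {le_a Ia} => [->|k [b le_b Ib]]; last by exists b.
  by exists 0; rewrite size_poly0 sigma0 subrr; split=> //; apply: gen_ideal0.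
have IFab : gen_ideal hypell (F - (sigma k a + wvar * sigma k.-1 b)).
  have I_F := gen_idealD IF (gen_idealD Ia (gen_idealMl wvar Ib)).
  by apply: (gen_ideal_eq I_F); ring.
exists a, b; split=> //; have := phi_hypell IFab; rewrite phiB => /eqP.
rewrite subr_eq0 => /eqP->; rewrite phiD phiM !phi_sigma // phi_wvar.
by apply: quadP; rewrite /= !(mul0r, mulr0, mul1r, add0r, addr0).
Qed.

Lemma phi_eq0_homog k F : F \is k.-homog -> phi F = 0 -> gen_ideal hypell F.
Proof.
move=> /normal_form[a [b [_ _ _ IF ->]]] [] a0 b0; move: IF.
have := congr1 (fun P : {poly {poly K}} => P`_k) a0.
have := congr1 (fun P : {poly {poly K}} => P`_k.-1) b0.
rewrite !coefCM !coefXn !eqxx !mulr1 !coef0 => -> ->.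
by rewrite !sigma0 mulr0 addr0 subr0.
Qed.

(** Homogeneous components cannot cancel under [phi]: the one of degree [k] contributes only [t ^ k]
    to [rpart] and [t ^ (k - 1)] to [ipart]. *)
Lemma phi_eq0 F : phi F = 0 -> gen_ideal hypell F.
Proof.
have -> := pihomog_partitionE (mf := mdeg) (leqnn (msize F)).
set m := msize F; move=> F0; apply: gen_ideal_sum => -[k lt_k] _ /=.
apply: (phi_eq0_homog (pihomogP _ k F)).
have nf j := normal_form (pihomogP mdeg j F).
move: F0; rewrite phi_sum => F0.
have [a [b [_ _ b0 _ phik]]] := nf k.
suff [a0 bE0] : a = 0 /\ b = 0.
  by rewrite phik a0 bE0; apply: quadP; rewrite /= mul0r.
split.
  have := congr1 (fun z : quad c => (rpart z : {poly {poly K}})`_k) F0.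
  rewrite raddf_sum coef_sum (bigD1 (Ordinal lt_k)) //= phik /=.
  rewrite coefCM coefXn eqxx mulr1 coef0 big1 ?addr0 // => j neq_jk.
  have [a' [b' [_ _ _ _ ->]]] := nf j; rewrite /= coefCM coefXn.
  by rewrite eq_sym -(inj_eq val_inj) in neq_jk; rewrite (negPf neq_jk) mulr0.
have [/b0 //|k_gt0] := posnP k.
have := congr1 (fun z : quad c => (ipart z : {poly {poly K}})`_k.-1) F0.
rewrite raddf_sum coef_sum (bigD1 (Ordinal lt_k)) //= phik /=.
rewrite coefCM coefXn eqxx mulr1 coef0 big1 ?addr0 // => j neq_jk.
have [a' [b' [_ _ b'0 _ ->]]] := nf j; rewrite /= coefCM coefXn.
(* The truncated predecessor gives degrees 0 and 1 the same exponent, but [b'] vanishes in degree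
   0. *)
have [/b'0-> | j_gt0] := posnP j; first by rewrite mul0r.
rewrite -(inj_eq val_inj) /= in neq_jk.
by rewrite (_ : (k.-1 == j.-1) = false) ?mulr0 //; apply/eqP; lia.
Qed.

Lemma gen_hypellE F : gen_ideal hypell F <-> phi F = 0.
Proof. by split; [apply: phi_hypell|apply: phi_eq0]. Qed.

End HyperellipticModel.

(** Parity of the multiplicity at [z]: even on the left and odd on the right, unless [q = 0]. *)
Lemma sqr_simple_root (K : fieldType) (f p q : {poly K}) (z : K) :
  root f z -> ~~ root f^`() z -> p ^+ 2 = f * q ^+ 2 -> q = 0.
Proof.
move=> fz0 f'z0 Epq; apply/eqP/negPn/negP => q_neq0.
have f_neq0 : f != 0 by apply: contraNneq f'z0 => ->; rewrite deriv0 root0.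
have p_neq0 : p != 0.
  apply: contraNneq f_neq0 => p0; move/esym/eqP: Epq.
  by rewrite p0 expr0n mulf_eq0 expf_eq0 /= (negPf q_neq0) orbF.
have muf : mup z f = 1%N.
  apply/eqP; rewrite eqn_leq mup_geq // expr1 -root_factor_theorem fz0 andbT.
  rewrite leqNgt mup_geq //; apply: contra f'z0 => /dvdpP[g ->].
  by rewrite /root derivM expr2 derivM !hornerE /= subrr !(mulr0, mul0r, addr0) eqxx.
have := congr1 (mup z) Epq.
rewrite !expr2 !mupM ?mulf_neq0 // muf; lia.
Qed.

(** * Primality and the Hilbert function *)

Section CoordinateRing.
Variables (K : fieldType) (G : nat) (f : {poly K}).
Hypothesis size_f : (size f <= G.*2.+1)%N.

(** By [gen_hypellE] the quotient embeds in the quadratic extension, which has no zero divisors once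
    its norm form has no nontrivial zero; the simple root of [f] ensures this. *)
Lemma hypell_prime (z : K) : root f z -> ~~ root f^`() z ->
  prime_ideal (gen_ideal (hypell G f)).
Proof.
move=> fz0 f'z0; split.
  move/(gen_hypellE size_f); rewrite phi1 => /(congr1 (@rpart _ _)) /eqP.
  by rewrite oner_eq0.
move=> F H /(gen_hypellE size_f); rewrite phiM => FH0.
suff [F0|H0] : phi f F = 0 \/ phi f H = 0.
- by left; apply/(gen_hypellE size_f).
- by right; apply/(gen_hypellE size_f).
apply: quad_mulf_eq0 FH0 => a b Eab.
suff b0 : b = 0.
  split=> //; move/eqP: Eab; rewrite b0 expr0n mulr0 expf_eq0 /=.
  by move/eqP.
apply/eqP; rewrite -lead_coef_eq0; apply/eqP.
(* Comparing leading coefficients in [t] reduces the equation over [K[x][t]] to [a ^ 2 = f b ^ 2]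
   over [K[x]]. *)
apply: (sqr_simple_root fz0 f'z0 (p := lead_coef a)).
have := congr1 lead_coef Eab.
by rewrite !expr2 !lead_coefM lead_coefC !lead_coefX !mulr1.
Qed.

Variable k : nat.

(** In degree [k + 1], [phi F] has the form [a t ^ (k + 1) + b t ^ k sqrt c]; the row lists the
    coefficients of [a], of degree at most [(k + 1) G], and of [b], of degree at most [k G]. *)
Definition graded_part (F : dhomog G.+2 K k.+1) :
    'rV[K]_((k.+1 * G).+1 + (k * G).+1) :=
  row_mx (\row_i (rpart (phi f (mpoly_of_dhomog F)) : {poly {poly K}})`_k.+1`_i)
         (\row_i (ipart (phi f (mpoly_of_dhomog F)) : {poly {poly K}})`_k`_i).

Lemma rpart_phi_linear j i a (F H : {mpoly K[G.+2]}) :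
  (rpart (phi f (a *: F + H)) : {poly {poly K}})`_j`_i =
  a * (rpart (phi f F) : {poly {poly K}})`_j`_i
  + (rpart (phi f H) : {poly {poly K}})`_j`_i.
Proof. by rewrite phiD phiZ /= mul0r mulr0 addr0 !(coefD, coefCM). Qed.

Lemma ipart_phi_linear j i a (F H : {mpoly K[G.+2]}) :
  (ipart (phi f (a *: F + H)) : {poly {poly K}})`_j`_i =
  a * (ipart (phi f F) : {poly {poly K}})`_j`_i
  + (ipart (phi f H) : {poly {poly K}})`_j`_i.
Proof. by rewrite phiD phiZ /= mul0r addr0 !(coefD, coefCM). Qed.

Lemma graded_part_is_linear : linear graded_part.
Proof.
move=> a F H.
have E : mpoly_of_dhomog (a *: F + H) = a *: mpoly_of_dhomog F + mpoly_of_dhomog H.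
  exact: mpoly_of_dhomog_is_linear.
rewrite /graded_part E; apply/rowP => j.
rewrite [LHS]mxE [RHS]mxE [X in _ = X + _]mxE.
rewrite [X in _ = _ * X + _]mxE [X in _ = _ + X]mxE.
case: (split j) => i;
  rewrite [LHS]mxE [X in _ = _ * X + _]mxE [X in _ = _ + X]mxE.
- exact: rpart_phi_linear.
- exact: ipart_phi_linear.
Qed.

HB.instance Definition _ := GRing.isLinear.Build K (dhomog G.+2 K k.+1)
  'rV[K]_((k.+1 * G).+1 + (k * G).+1) _ graded_part graded_part_is_linear.

Lemma graded_part_eq0 F :
  (graded_part F == 0) <-> gen_ideal (hypell G f) (mpoly_of_dhomog F).
Proof.
have [a [b [le_a le_b _ _ phiF]]] := normal_form size_f (dhomog_is_dhomog F).
rewrite (gen_hypellE size_f); split=> [/eqP F0|F0]; last first.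
  apply/eqP/rowP => j; rewrite !mxE.
  by case: splitP => i _; rewrite !mxE F0 /= !coef0.
have ca i : (i < (k.+1 * G).+1)%N -> a`_i = 0.
  move=> lt_i; move/rowP/(_ (lshift _ (Ordinal lt_i))): F0.
  by rewrite row_mxEl !mxE phiF /= coefCM coefXn eqxx mulr1.
have cb i : (i < (k * G).+1)%N -> b`_i = 0.
  move=> lt_i; move/rowP/(_ (rshift _ (Ordinal lt_i))): F0.
  by rewrite row_mxEr !mxE phiF /= coefCM coefXn eqxx mulr1.
have a0 : a = 0.
  apply/polyP => i; rewrite coef0; case: (ltnP i (k.+1 * G).+1) => [/ca //|le_i].
  by rewrite nth_default // (leq_trans le_a).
have b0 : b = 0.
  apply/polyP => i; rewrite coef0; case: (ltnP i (k * G).+1) => [/cb //|le_i].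
  by rewrite nth_default // (leq_trans le_b).
by rewrite phiF a0 b0; apply: quadP; rewrite /= mul0r.
Qed.

Lemma graded_part_surj v : exists F, graded_part F = v.
Proof.
pose F : {mpoly K[G.+2]} :=
  sigma G k.+1 (rVpoly (lsubmx v)) + wvar K G * sigma G k (rVpoly (rsubmx v)).
have hF : F \is k.+1.-homog.
  apply: rpredD; first exact: homog_sigma.
  by apply: (@dhomogM _ _ _ 1 _ k); [apply: homog_wvar|apply: homog_sigma].
exists (DHomog hF); rewrite /graded_part /F /= phiD phiM phi_wvar.
rewrite !phi_sigma ?size_poly //= -[RHS]hsubmxK.
apply/rowP => j; rewrite !mxE; case: splitP => i _;
  by rewrite !mxE !(mul0r, mulr0, mul1r, add0r, addr0) coefCM coefXn eqxx mulr1
    coef_rVpoly_ord ?mxE.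
Qed.

End CoordinateRing.

(** Rank-nullity for [graded_part]: its kernel is the degree [k + 1] component of the ideal, and it
    is surjective. *)
Lemma hypell_hilbert (G : nat) (f : {poly rat}) (k : nat) :
  (size f <= G.*2.+1)%N ->
  hilbert_value (hypell G f) k.+1 ((k.+1 * G).+1 + (k * G).+1).
Proof.
move=> size_f; exists (lker (linfun (@graded_part _ G f k))); split.
  move=> F; rewrite memv_ker lfunE /=.
  exact: graded_part_eq0.
have := limg_ker_dim (linfun (@graded_part _ G f k)) fullv.
rewrite capfv => <-; congr (_ + _)%N.
have -> : limg (linfun (@graded_part _ G f k)) = fullv.
  apply/vspaceP => v; rewrite memvf; have [F <-] := graded_part_surj f v.
  by apply/memv_imgP; exists F; rewrite ?memvf // lfunE.
by rewrite dimvf /dim /= mul1n.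
Qed.

Lemma hypell_genus (G : nat) (f : {poly rat}) :
  (0 < G)%N -> (size f <= G.*2.+1)%N -> dim1_genus (hypell G f) G.-1.
Proof.
(* The model has degree [2 G]; the count starts at [k = 1], since in degree 0 there is no [w]
   component. *)
move=> G_gt0 size_f; exists G.*2; first by rewrite double_gt0.
exists 1%N => -[//|k] _; exists ((k.+1 * G).+1 + (k * G).+1)%N.
  exact: hypell_hilbert.
by case: G G_gt0 {size_f} => // g _ /=; lia.
Qed.

Lemma base_change_hypell (G : nat) (f : {poly rat}) :
  base_change (hypell G f) = hypell G (map_poly ratr f).
Proof.
have mapu i : map_mpoly ratr (uvar rat G i) = uvar algC G i by apply: map_mpolyX.
have mapq k : map_mpoly ratr (umon rat G k) = umon algC G k.
  by rewrite /umon; case: ifP => _; rewrite rmorphM /= !mapu.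
rewrite /base_change /hypell map_cons map_allpairs; congr (_ :: _).
  rewrite rmorphB rmorphXn /=; congr (_ ^+ 2 - _); first exact: map_mpolyX.
  rewrite /uform rmorph_sum; apply: eq_bigr => k _.
  by rewrite /= map_mpolyZ mapq coef_map.
apply: eq_allpairs => i j.
by rewrite /scroll rmorphB rmorphM /= !mapu mapq.
Qed.

(** * Smoothness of the model *)

Section DirectionalDerivative.
Variables (K : fieldType) (n : nat) (x v : 'rV[K]_n).

(** A row vector kills the transposed Jacobian matrix iff the derivatives of all equations along it
    vanish, so the rank can be found from tangent vectors by the product rule. *)
Definition dirder (g : {mpoly K[n]}) : K := \sum_j v ord0 j * (g^`M(j)).@[x ord0].

Lemma dirderD g h : dirder (g + h) = dirder g + dirder h.
Proof.
by rewrite -big_split; apply: eq_bigr => j _; rewrite mderivD mevalD mulrDr.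
Qed.

Lemma dirderZ a g : dirder (a *: g) = a * dirder g.
Proof.
rewrite mulr_sumr; apply: eq_bigr => j _.
by rewrite mderivZ mevalZ mulrCA.
Qed.

Lemma dirderB g h : dirder (g - h) = dirder g - dirder h.
Proof. by rewrite -scaleN1r dirderD dirderZ mulN1r. Qed.

Lemma dirder0 : dirder 0 = 0.
Proof. by rewrite -(scale0r 0) dirderZ mul0r. Qed.

Lemma dirder_sum (I : Type) (r : seq I) (P : pred I) (F : I -> {mpoly K[n]}) :
  dirder (\sum_(i <- r | P i) F i) = \sum_(i <- r | P i) dirder (F i).
Proof. exact: (big_morph _ dirderD dirder0). Qed.

Lemma dirderM g h :
  dirder (g * h) = dirder g * h.@[x ord0] + g.@[x ord0] * dirder h.
Proof.
rewrite mulr_suml mulr_sumr -big_split; apply: eq_bigr => j _ /=.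
by rewrite mderivM mevalD !mevalM; ring.
Qed.

Lemma dirderX k : dirder 'X_k = v ord0 k.
Proof.
rewrite /dirder (bigD1 k) //= mderivX mnm1E eqxx scale1r.
rewrite (_ : (U_(k) - U_(k) = 0)%MM); last first.
  by apply/mnmP => i; rewrite mnmBE subnn mnm0E.
rewrite mpolyX0 meval1 mulr1 big1 ?addr0 // => j neq_jk.
by rewrite mderivX mnm1E eq_sym (negPf neq_jk) scale0r meval0 mulr0.
Qed.

End DirectionalDerivative.

Lemma rank_kermx2 (K : fieldType) (m n : nat) (M : 'M[K]_(n, m)) (p q : 'rV[K]_n) :
  (forall v : 'rV_n, v *m M = 0 <-> exists a b, v = a *: p + b *: q) ->
  (forall a b, a *: p + b *: q = 0 -> a = 0 /\ b = 0) ->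
  \rank (kermx M) = 2.
Proof.
move=> kerE free_pq.
have -> : \rank (kermx M) = \rank (col_mx p q).
  apply/eqP; rewrite eqn_leq; apply/andP; split; apply: mxrankS.
    apply/rV_subP => v /sub_kermxP/kerE[a [b ->]].
    by apply/submxP; exists (row_mx a%:M b%:M); rewrite mul_row_col !mul_scalar_mx.
  rewrite col_mx_sub; apply/andP; split; apply/sub_kermxP/kerE.
    by exists 1, 0; rewrite scale1r scale0r addr0.
  by exists 0, 1; rewrite scale1r scale0r add0r.
apply/eqP; rewrite -[_ == _]/(row_free _) -kermx_eq0.
apply/rowV0P => v /sub_kermxP.
rewrite -[v]hsubmxK mul_row_col [lsubmx v]mx11_scalar [rsubmx v]mx11_scalar.
rewrite !mul_scalar_mx => /free_pq[-> ->].
by rewrite !raddf0 row_mx0.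
Qed.

Section Coordinates.
Variables (K : fieldType) (G : nat).
Implicit Types v : 'rV[K]_G.+2.

Definition ucoord v i : K := v ord0 (inord i).
Definition wcoord v : K := v ord0 ord_max.

Lemma row_coordP v v' :
  (forall i, (i <= G)%N -> ucoord v i = ucoord v' i) ->
  wcoord v = wcoord v' -> v = v'.
Proof.
move=> EU EW; apply/rowP => j.
have [->//|neq_j] := eqVneq j ord_max.
have le_j : (j <= G)%N.
  by have := ltn_ord j; move: neq_j; rewrite -val_eqE /=; lia.
by have := EU _ le_j; rewrite /ucoord inord_val.
Qed.

Definition row_of (p : nat -> K) (y : K) : 'rV[K]_G.+2 :=
  \row_j if j == ord_max then y else p j.

Lemma ucoord_row_of p y i : (i <= G)%N -> ucoord (row_of p y) i = p i.
Proof.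
move=> le_i; rewrite /ucoord mxE ifF ?inordK //; first exact: leqW.
by apply/eqP=> /(congr1 val) /=; rewrite inordK ?ltnS; lia.
Qed.

Lemma wcoord_row_of p y : wcoord (row_of p y) = y.
Proof. by rewrite /wcoord mxE eqxx. Qed.

Lemma ucoord_lin a b v v' i :
  ucoord (a *: v + b *: v') i = a * ucoord v i + b * ucoord v' i.
Proof. by rewrite /ucoord !mxE. Qed.

Lemma wcoord_lin a b v v' :
  wcoord (a *: v + b *: v') = a * wcoord v + b * wcoord v'.
Proof. by rewrite /wcoord !mxE. Qed.

End Coordinates.

Section Smoothness.
Variables (K : fieldType) (G : nat) (f : {poly K}) (x : 'rV[K]_G.+2).
Hypotheses (two_neq0 : 2 != 0 :> K) (G_gt1 : (1 < G)%N).
Hypotheses (size_f : (size f <= G.*2.+1)%N) (size_f_ge : (G.*2 <= size f)%N).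
Hypothesis f_sep : forall z, root f z -> ~~ root f^`() z.
Hypothesis x_neq0 : x != 0.
Hypothesis x_zero : forall g, g \in hypell G f -> g.@[x ord0] = 0.

Local Notation M := (\matrix_(i < size (hypell G f), j < G.+2)
  (((hypell G f)`_i)^`M(j)).@[x ord0]).

Local Notation U := ucoord.
Local Notation W := wcoord.

Lemma ker_jacobianP (v : 'rV[K]_G.+2) :
  v *m M^T = 0 <-> forall g, g \in hypell G f -> dirder x v g = 0.
Proof.
have E i : (v *m M^T) ord0 i = dirder x v (hypell G f)`_i.
  by rewrite mxE; apply: eq_bigr => j _; rewrite !mxE.
split=> [v0 g g_in | v0].
  have lt_i : (index g (hypell G f) < size (hypell G f))%N by rewrite index_mem.
  have := E (Ordinal lt_i); rewrite v0 mxE /= nth_index // => <- //.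
by apply/rowP => i; rewrite E mxE v0 // mem_nth.
Qed.

(* If [w != 0] the last equation determines [v_w]; if [w = 0] the branch point is
   simple ([B != 0]), so that [b = 0] and [v_w] is free. The kernel is a plane in
   both cases. *)
Lemma rank_jacobian_of_kernel (p q : nat -> K) (A B : K) :
  (forall a b, (forall i, (i <= G)%N -> a * p i + b * q i = 0) ->
     a = 0 /\ b = 0) ->
  (W x = 0 -> A = 0 /\ B != 0) ->
  (forall v, v *m M^T = 0 <-> exists a b,
     (forall i, (i <= G)%N -> U v i = a * p i + b * q i) /\
     2 * W x * W v = a * A + b * B) ->
  (\rank M).+1 = G.+1.
Proof.
(* There are [G + 2] coordinates, so rank [G] means a kernel of dimension 2. *)
move=> free_pq W0 kerE; suff r2 : \rank (kermx M^T) = 2.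
  have := mxrank_ker M^T; rewrite r2 mxrank_tr.
  by have := rank_leq_col M; lia.
have [Wx0|Wx_neq0] := eqVneq (W x) 0; last first.
  pose y := (2 * W x)^-1.
  have yK : 2 * W x * y = 1 by rewrite mulfV // mulf_neq0.
  apply: (@rank_kermx2 _ _ _ _ (row_of G p (y * A)) (row_of G q (y * B))).
    move=> v; rewrite kerE; split=> [[a [b [EU EW]]]|[a [b ->]]]; exists a, b.
      apply: row_coordP => [i le_i|].
        by rewrite ucoord_lin !ucoord_row_of // EU.
      rewrite wcoord_lin !wcoord_row_of -[LHS]mul1r -yK mulrAC EW;
 ring.
    split=> [i le_i|]; first by rewrite ucoord_lin !ucoord_row_of.
    transitivity (2 * W x * y * (a * A + b * B)); last by rewrite yK mul1r.
    by rewrite wcoord_lin !wcoord_row_of; ring.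
  move=> a b ab0; apply: free_pq => i le_i.
  have := congr1 (fun v => U v i) ab0.
  by rewrite /= ucoord_lin !ucoord_row_of // /ucoord mxE.
have [A0 B_neq0] := W0 Wx0.
apply: (@rank_kermx2 _ _ _ _ (row_of G p 0) (row_of G (fun=> 0) 1)).
  move=> v; rewrite kerE; split=> [[a [b [EU EW]]]|[a [b ->]]].
    have b0 : b = 0.
      apply/eqP; move/esym/eqP: EW.
      by rewrite Wx0 A0 !mulr0 mul0r add0r mulf_eq0 (negPf B_neq0) orbF.
    exists a, (W v); apply: row_coordP => [i le_i|].
      by rewrite ucoord_lin !ucoord_row_of // EU // b0 mul0r mulr0.
    by rewrite wcoord_lin !wcoord_row_of mulr0 add0r mulr1.
  exists a, 0; split=> [i le_i|].
    by rewrite ucoord_lin !ucoord_row_of // mulr0 mul0r.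
  by rewrite Wx0 A0; ring.
move=> a b ab0.
have b0 : b = 0.
  have := congr1 (@W K G) ab0.
  by rewrite wcoord_lin !wcoord_row_of mulr0 mulr1 add0r /wcoord mxE.
split=> //; have [|-> //] := free_pq a 0.
move=> i le_i; have := congr1 (fun v => U v i) ab0.
by rewrite /= ucoord_lin !ucoord_row_of // /ucoord mxE b0 !mul0r.
Qed.

Lemma eval_uvar i : (uvar K G i).@[x ord0] = U x i.
Proof. exact: mevalXU. Qed.

Lemma eval_wvar : (wvar K G).@[x ord0] = W x.
Proof. exact: mevalXU. Qed.

Lemma dirder_uvar v i : dirder x v (uvar K G i) = U v i.
Proof. exact: dirderX. Qed.

Lemma dirder_wvar v : dirder x v (wvar K G) = W v.
Proof. exact: dirderX. Qed.

Lemma dirder_umon v k : dirder x v (umon K G k) =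
  if (k <= G)%N then U v 0 * U x k + U x 0 * U v k
  else U v G * U x (k - G) + U x G * U v (k - G).
Proof.
by rewrite /umon; case: ifP => _; rewrite dirderM !dirder_uvar !eval_uvar.
Qed.

Lemma eval_umon k : (umon K G k).@[x ord0] =
  if (k <= G)%N then U x 0 * U x k else U x G * U x (k - G).
Proof.
by rewrite /umon; case: ifP => _; rewrite mevalM !eval_uvar.
Qed.

Lemma eval_uform : (uform G f).@[x ord0] =
  \sum_(k < G.*2.+1) f`_k * (umon K G k).@[x ord0].
Proof. by rewrite raddf_sum; apply: eq_bigr => k _; apply: mevalZ. Qed.

Lemma scroll_eq i j : (i <= G)%N -> (j <= G)%N ->
  U x i * U x j = (umon K G (i + j)).@[x ord0].
Proof.
move=> le_i le_j; apply/eqP; rewrite -subr_eq0 -!eval_uvar -mevalM -mevalB.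
by apply/eqP/x_zero/hypellP; right; exists i, j.
Qed.

Lemma curve_eq : W x ^+ 2 = \sum_(k < G.*2.+1) f`_k * (umon K G k).@[x ord0].
Proof.
have : (wvar K G ^+ 2 - uform G f).@[x ord0] = 0 by apply/x_zero/hypellP; left.
rewrite mevalB => /eqP; rewrite subr_eq0 rmorphXn /= eval_wvar => /eqP->.
exact: eval_uform.
Qed.

Lemma kerP v : v *m M^T = 0 <->
  (forall i j, (i <= G)%N -> (j <= G)%N ->
     U v i * U x j + U x i * U v j = dirder x v (umon K G (i + j))) /\
  2 * W x * W v = \sum_(k < G.*2.+1) f`_k * dirder x v (umon K G k).
Proof.
have dS i j : dirder x v (scroll K G i j) =
    U v i * U x j + U x i * U v j - dirder x v (umon K G (i + j)).
  by rewrite dirderB dirderM !dirder_uvar !eval_uvar.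
have dW : dirder x v (wvar K G ^+ 2 - uform G f) =
    2 * W x * W v - \sum_(k < G.*2.+1) f`_k * dirder x v (umon K G k).
  rewrite dirderB expr2 dirderM dirder_wvar eval_wvar dirder_sum.
  congr (_ - _); first by ring.
  by apply: eq_bigr => k _; rewrite dirderZ.
rewrite ker_jacobianP; split=> [v0|[vS vW] g /hypellP[->|[i [j [le_i le_j ->]]]]].
- split=> [i j le_i le_j|]; apply/eqP; rewrite -subr_eq0 -?dS -?dW; apply/eqP/v0.
    by apply/hypellP; right; exists i, j.
  by apply/hypellP; left.
- by rewrite dW vW subrr.
- by rewrite dS vS // subrr.
Qed.

Lemma horner_f z : f.[z] = \sum_(k < G.*2.+1) f`_k * z ^+ k.
Proof. exact: horner_coef_wide. Qed.

(** The derivative of [x ^ k] at [z]; for [k = 0] the factor [k] makes the truncated predecessor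
    harmless. *)
Let dexp z k : K := k%:R * z ^+ k.-1.

Lemma horner_deriv_f z : f^`().[z] = \sum_(k < G.*2.+1) f`_k * dexp z k.
Proof.
rewrite [in LHS](poly_sum_Xn size_f) raddf_sum horner_sum; apply: eq_bigr => k _.
by rewrite /= derivZ derivXn hornerZ hornerMn hornerXn /dexp mulr_natl.
Qed.

Lemma dexpD z i j : dexp z (i + j) = dexp z i * z ^+ j + z ^+ i * dexp z j.
Proof.
rewrite /dexp; case: i j => [|i] [|j] /=; rewrite ?addn0 ?add0n ?expr0; try by ring.
by rewrite natrD !exprD !exprS; ring.
Qed.

(** The [u]-part of the point is [r (1, z, ..., z ^ G)], and that of a tangent vector is spanned by
    the cone direction [z ^ i] and its derivative in [z]. At a branch point, [f' z] is nonzero by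
    separability. *)
Lemma smooth_affine : U x 0 != 0 -> (\rank M).+1 = G.+1.
Proof.
set r := U x 0 => r_neq0; pose z := U x 1 / r.
have zE : U x 1 = r * z by rewrite mulrC divfK.
(* The relations [u_1 u_i = u_0 u_(i + 1)] force a geometric progression. *)
have EU i : (i <= G)%N -> U x i = r * z ^+ i.
  elim: i => [|i IHi] lt_i; first by rewrite mulr1.
  have := @scroll_eq 1 i (ltnW G_gt1) (ltnW lt_i).
  rewrite eval_umon add1n lt_i -/r IHi 1?ltnW // zE => E.
  by apply: (mulfI r_neq0); rewrite -E exprS; ring.
have Emon k : (k <= G.*2)%N -> (umon K G k).@[x ord0] = r ^+ 2 * z ^+ k.
  rewrite eval_umon -/r => le_k; case: leqP => lt_k; first by rewrite EU //; ring.
  rewrite !EU //; last lia.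
  by rewrite -[in RHS](subnKC (ltnW lt_k)) exprD; ring.
have EW : W x ^+ 2 = r ^+ 2 * f.[z].
  rewrite curve_eq horner_f mulr_sumr; apply: eq_bigr => k _.
  by rewrite Emon; [apply: mulrCA|rewrite -ltnS].
have DE v a b : (forall i, (i <= G)%N -> U v i = a * z ^+ i + b * dexp z i) ->
    forall k, (k <= G.*2)%N ->
    dirder x v (umon K G k) = r * (2 * a * z ^+ k + b * dexp z k).
  move=> Ev k le_k; rewrite dirder_umon -/r; case: leqP => lt_k.
    by rewrite (Ev 0%N) // EU // Ev // /dexp /=; ring.
  rewrite !Ev // ?EU //; try lia.
  by rewrite -[in RHS](subnKC (ltnW lt_k)) dexpD exprD; ring.
(* The last two arguments are the derivatives of the quadratic form [uform] along the two
   directions. *)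
apply: (@rank_jacobian_of_kernel (fun i => z ^+ i) (dexp z) (2 * r * f.[z])
  (r * f^`().[z])).
- move=> a b ab0; have := ab0 0%N isT; rewrite /dexp mul0r mulr0 addr0 mulr1 => a0.
  split=> //; have := ab0 1%N (ltnW G_gt1).
  by rewrite a0 mul0r add0r /dexp !mulr1.
- move=> W0; have fz0 : f.[z] = 0.
    apply/eqP; move/esym/eqP: EW.
    by rewrite W0 expr0n mulf_eq0 expf_eq0 /= (negPf r_neq0).
  by rewrite fz0 mulr0; split=> //; rewrite mulf_neq0 //; apply/f_sep/eqP.
have sumE v a b : (forall i, (i <= G)%N -> U v i = a * z ^+ i + b * dexp z i) ->
    \sum_(k < G.*2.+1) f`_k * dirder x v (umon K G k) =
    a * (2 * r * f.[z]) + b * (r * f^`().[z]).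
  move=> Ev; rewrite horner_f horner_deriv_f !mulr_sumr -big_split.
  apply: eq_bigr => k _; rewrite (DE _ _ _ Ev) /=; last by rewrite -ltnS.
  by ring.
move=> v; rewrite kerP; split=> [[vS vW]|[a [b [Ev vW]]]]; last first.
  split=> [i j le_i le_j|]; last by rewrite vW (sumE _ _ _ Ev).
  rewrite (DE _ _ _ Ev); last lia.
  rewrite !Ev // !EU // dexpD exprD; ring.
(* Differentiating [u_1 u_i = u_0 u_(i + 1)] determines the [u]-part of a tangent vector from its
   first two entries. *)
pose a := U v 0; pose b := U v 1 - z * U v 0.
have Ev i : (i <= G)%N -> U v i = a * z ^+ i + b * dexp z i.
  elim: i => [|i IHi] lt_i; first by rewrite /dexp /a; ring.
  have := vS 1%N i (ltnW G_gt1) (ltnW lt_i).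
  rewrite dirder_umon add1n lt_i -/r IHi 1?ltnW // zE !EU // 1?ltnW // => E.
  apply: (mulfI r_neq0); rewrite -[LHS](addKr (U v 0 * (r * z ^+ i.+1))) -E.
  by rewrite -add1n dexpD /dexp /= /b exprD; rewrite -/a; ring.
by exists a, b; split=> //; rewrite vW (sumE _ _ _ Ev).
Qed.

(** At infinity only [u_G] and [w] can be nonzero; the coefficients of [x ^ (2 G)] and
    [x ^ (2 G - 1)] in [f] take over the roles of [f z] and [f' z]. *)
Lemma smooth_infinity : U x 0 = 0 -> (\rank M).+1 = G.+1.
Proof.
move=> U0; have Ui i : (i < G)%N -> U x i = 0.
  have [N] := ubnP i; elim: N i => // N IHN i le_i lt_i.
  (* [u_i ^ 2] equals either [u_0 u_(2 i) = 0] or [u_G u_(2 i - G)], where [2 i - G < i]. *)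
  have := scroll_eq (ltnW lt_i) (ltnW lt_i); rewrite eval_umon U0 mul0r.
  have -> : (if (i + i <= G)%N then 0 else U x G * U x (i + i - G)) = 0.
    case: leqP => // lt_G; rewrite [U x (i + i - G)]IHN ?mulr0 //; lia.
  by move/eqP; rewrite mulf_eq0 orbb => /eqP.
have Emon k : (k <= G.*2)%N ->
    (umon K G k).@[x ord0] = if k == G.*2 then U x G ^+ 2 else 0.
  rewrite eval_umon U0 mul0r => le_k; case: leqP => lt_k.
    by rewrite ifF //; apply/eqP; lia.
  case: eqP => [->|neq_k]; first by rewrite -addnn addnK expr2.
  by rewrite [U x (k - G)]Ui ?mulr0 //; lia.
have EW : W x ^+ 2 = U x G ^+ 2 * f`_G.*2.
  rewrite curve_eq big_ord_recr /= Emon // eqxx big1 ?add0r 1?mulrC // => k _.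
  by rewrite Emon ?ifF ?mulr0 //; [apply/eqP|]; have := ltn_ord k; lia.
set r := U x G in Emon EW *.
have r_neq0 : r != 0.
  apply: contraNneq x_neq0 => r0; apply/eqP/row_coordP => [i|].
    by rewrite leq_eqVlt => /orP[/eqP->|/Ui->]; rewrite ?[U x G]r0 /ucoord mxE.
  move/eqP: EW; rewrite r0 expr0n mul0r expf_eq0 /= => /eqP->.
  by rewrite /wcoord mxE.
(* Near this point of the rational normal curve [u_(G - 1) / u_G] is a local parameter, so tangent
   vectors have their [u]-part supported on the indices [G] and [G - 1]. *)
pose p i : K := (i == G)%:R; pose q i : K := (i == G.-1)%:R.
have pG : p G = 1 by rewrite /p eqxx.
have qG : q G = 0 by rewrite /q (_ : (G == G.-1) = false) //; apply/eqP; lia.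
have DE v a b : (forall i, (i <= G)%N -> U v i = a * p i + b * q i) ->
    forall k, (k <= G.*2)%N -> dirder x v (umon K G k) =
      r * (2 * a * (k == G.*2)%:R + b * (k == G.*2.-1)%:R).
  move=> Ev k le_k; have v0 : U v 0 = 0.
    have [G0 G1] : (0%N == G) = false /\ (0%N == G.-1) = false.
      by split; apply/eqP; lia.
    by rewrite Ev // /p /q G0 G1 !mulr0 addr0.
  rewrite dirder_umon v0 U0 !mul0r addr0 -/r; case: leqP => lt_k.
    have [k0 k1] : (k == G.*2) = false /\ (k == G.*2.-1) = false.
      by split; apply/eqP; lia.
    by rewrite k0 k1 !mulr0 addr0 mulr0.
  rewrite !Ev //; last lia.
  rewrite pG qG /p /q.
  have -> : (k - G == G)%N = (k == G.*2) by apply/eqP/eqP; lia.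
  have -> : (k - G == G.-1)%N = (k == G.*2.-1) by apply/eqP/eqP; lia.
  have [->|neq_k] := eqVneq k G.*2.
    by rewrite (_ : G.*2 - G = G)%N -/r /=; [ring|lia].
  by rewrite [U x (k - G)]Ui /=; [ring|lia].
apply: (@rank_jacobian_of_kernel p q (2 * r * f`_G.*2) (r * f`_G.*2.-1)).
- move=> a b ab0; have := ab0 G (leqnn _); rewrite pG qG mulr0 addr0 mulr1 => a0.
  split=> //; have := ab0 G.-1 (leq_pred _).
  by rewrite a0 mul0r add0r /q eqxx mulr1.
- move=> W0; have f0 : f`_G.*2 = 0.
    apply/eqP; move/esym/eqP: EW.
    by rewrite W0 expr0n mulf_eq0 expf_eq0 /= (negPf r_neq0).
  rewrite f0 mulr0; split=> //; rewrite mulf_neq0 //.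
  (* Without a term of degree [2 G], the bound [size_f_ge] makes the term of degree [2 G - 1] the
     leading one, so infinity is a simple branch point. *)
  have f_neq0 : f != 0 by rewrite -size_poly_gt0; lia.
  suff -> : G.*2.-1 = (size f).-1 by rewrite -lead_coefE lead_coef_eq0.
  suff : size f != G.*2.+1 by lia.
  apply: contraNneq f_neq0 => sf; rewrite -lead_coef_eq0 lead_coefE sf /=.
  by rewrite f0.
have sumE v a b : (forall i, (i <= G)%N -> U v i = a * p i + b * q i) ->
    \sum_(k < G.*2.+1) f`_k * dirder x v (umon K G k) =
    a * (2 * r * f`_G.*2) + b * (r * f`_G.*2.-1).
  move=> Ev; rewrite (eq_bigr (fun k : 'I_G.*2.+1 =>
    f`_k * (r * (2 * a)) * (k == G.*2 :> nat)%:R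
    + f`_k * (r * b) * (k == G.*2.-1 :> nat)%:R)); last first.
    move=> k _; rewrite (DE _ _ _ Ev) /=; last by rewrite -ltnS.
    by ring.
  have pick (c : nat -> K) m : (m < G.*2.+1)%N ->
      \sum_(k < G.*2.+1) c k * (k == m :> nat)%:R = c m.
    move=> lt_m; rewrite (bigD1 (Ordinal lt_m)) //= eqxx mulr1 big1 ?addr0 //.
    by move=> k; rewrite -(inj_eq val_inj) /= => /negPf->; rewrite mulr0.
  rewrite big_split /= (pick (fun k => f`_k * (r * (2 * a)))) //.
  rewrite (pick (fun k => f`_k * (r * b))); last lia.
  by ring.
move=> v; rewrite kerP; split=> [[vS vW]|[a [b [Ev vW]]]]; last first.
  split=> [i j le_i le_j|]; last by rewrite vW (sumE _ _ _ Ev).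
  have Up m : (m <= G)%N -> U x m = r * p m.
    rewrite leq_eqVlt => /orP[/eqP->|lt_m]; first by rewrite pG mulr1.
    by rewrite Ui // /p (_ : (m == G) = false) ?mulr0 //; apply/eqP; lia.
  have pp : p i * p j = (i + j == G.*2)%:R.
    by rewrite /p -natrM mulnb; congr (_%:R); apply/eqP; case: eqP; case: eqP; lia.
  have pq : q i * p j + p i * q j = (i + j == G.*2.-1)%:R.
    rewrite /p /q -!natrM -natrD; congr (_%:R); rewrite !mulnb.
    case: (i =P G.-1) => ?; case: (j =P G) => ?; case: (i =P G) => ?;
      case: (j =P G.-1) => ?; case: eqP => /=; lia.
  rewrite (DE _ _ _ Ev) -?pp -?pq; last lia.
  by rewrite !Ev // !Up //; ring.
have Ev i : (i <= G)%N -> U v i = U v G * p i + U v G.-1 * q i.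
  move=> le_i; have [->|neq_iG] := eqVneq i G.
    by rewrite pG qG mulr0 mulr1 addr0.
  rewrite /p (negPf neq_iG) mulr0 add0r /q.
  have [->|neq_iG1] := eqVneq i G.-1; first by rewrite mulr1.
  rewrite mulr0; apply: (mulfI r_neq0); rewrite mulr0.
  (* Differentiating the relation for [(i + 1, G - 1)] isolates [r * U v i]; the case [i = 0] is
     apart because [umon] is then [u_0 u_G]. *)
  have [i0|i_gt0] := posnP i.
    have := vS 1%N G.-1 (ltnW G_gt1) (leq_pred _).
    rewrite (_ : 1 + G.-1 = G)%N; last lia.
    rewrite dirder_umon leqnn U0 mul0r addr0 -/r => E.
    by rewrite i0 mulrC -E !Ui ?mulr0 ?mul0r ?addr0 //; lia.
  have le_i1 : (i.+1 <= G)%N by lia.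
  have := vS _ _ le_i1 (leq_pred _).
  rewrite dirder_umon (_ : i.+1 + G.-1 = G + i)%N; last lia.
  rewrite leqNgt (_ : G < G + i)%N /= ?addKn; last lia.
  rewrite (Ui i) ?mulr0 ?add0r -/r; last lia.
  by move=> <-; rewrite !Ui ?mulr0 ?mul0r ?addr0 //; lia.
by exists (U v G), (U v G.-1); split=> //; rewrite vW (sumE _ _ _ Ev).
Qed.

Lemma hypell_rank_jacobian : (\rank M).+1 = G.+1.
Proof.
by have [/smooth_infinity|/smooth_affine] := eqVneq (U x 0) 0.
Qed.

End Smoothness.

(** * Rational points on hyperelliptic curves *)

(** The two admissible sizes are the degrees [2 G - 1] and [2 G], with and without a branch point at
    infinity. Separability passes to [algC], where [f] has a simple root, as primality requires. *)
Lemma hypell_smooth_curve (G : nat) (f : {poly rat}) :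
  (1 < G)%N -> (G.*2 <= size f <= G.*2.+1)%N -> separable_poly f ->
  smooth_curve (hypell G f) G.-1.
Proof.
move=> G_gt1 /andP[size_f_ge size_f] sep_f.
pose fC := map_poly ratr f : {poly algC}.
have size_fC : size fC = size f by apply: size_map_poly.
have sep_fC z : root fC z -> ~~ root fC^`() z.
  rewrite deriv_map; apply: coprimep_root.
  by rewrite coprimep_map; move: sep_f; rewrite unlock.
split.
- by move=> g /hypell_homog; exists 2%N.
- rewrite base_change_hypell.
  have /closed_rootP[z fz0] : size fC != 1%N by rewrite size_fC; lia.
  by apply: (hypell_prime _ fz0 (sep_fC z fz0)); rewrite size_fC.
- rewrite /smooth_dim1 base_change_hypell => x [x_neq0 x_zero].
  by apply: hypell_rank_jacobian; rewrite ?size_fC ?pnatr_eq0.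
- by apply: hypell_genus; rewrite // ltnW.
Qed.

(** Each [b] yields the rational point [(1 : b : ... : b ^ G : w)]. For proportional points the
    first coordinate forces the scalar 1, and the second one recovers [b]. *)
Lemma hypell_points (G B : nat) (f : {poly rat}) (bs : seq rat) :
  (0 < G)%N -> (size f <= G.*2.+1)%N ->
  at_most_rational_points (hypell G f) B -> uniq bs ->
  (forall b, b \in bs -> exists w, w ^+ 2 = f.[b]) -> (size bs <= B)%N.
Proof.
move=> G_gt0 size_f ubB uniq_bs sq_bs.
have /choice[w wE] b : exists w, b \in bs -> w ^+ 2 = f.[b].
  by case: (boolP (b \in bs)) => [/sq_bs[w <-]|_]; [exists w|exists 0].
pose pt b : 'rV[rat]_G.+2 := row_of G (fun i => b ^+ i) (w b).
have ptE b i : (i <= G)%N -> ucoord (pt b) i = b ^+ i by apply: ucoord_row_of.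
rewrite -(size_map pt); apply: ubB => [_ /mapP[b bs_b ->]|].
  split.
    apply: contraTneq isT => pt0; have := ptE b 0%N isT.
    by rewrite pt0 /ucoord mxE expr0 => /eqP; rewrite eq_sym oner_eq0.
  have eU i : (i <= G)%N -> (uvar rat G i).@[pt b ord0] = b ^+ i.
    by move=> le_i; rewrite eval_uvar ptE.
  have eM k : (k <= G.*2)%N -> (umon rat G k).@[pt b ord0] = b ^+ k.
    move=> le_k; rewrite /umon; case: leqP => lt_k; rewrite mevalM !eU //; try lia.
      by rewrite mul1r.
    by rewrite -exprD subnKC // ltnW.
  move=> g /hypellP[->|[i [j [le_i le_j ->]]]]; rewrite mevalB; last first.
    by rewrite mevalM !eU // eM ?exprD ?subrr //; lia.
  rewrite rmorphXn /= eval_wvar wcoord_row_of wE // (horner_coef_wide _ size_f).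
  rewrite eval_uform -sumrB big1 // => k _ /=.
  by rewrite eM ?subrr // -ltnS.
rewrite pairwise_map; move: uniq_bs; rewrite uniq_pairwise.
apply: sub_pairwise => b b' /=; apply: contraNN => /andP[/sub_rVP[a E] _].
have := ptE b 0%N isT; rewrite E /ucoord mxE -/(ucoord _ _) ptE // !expr0 mulr1 => a1.
by have := ptE b 1%N G_gt0; rewrite E a1 scale1r ptE // !expr1 => ->.
Qed.

(** The genus of the curves used later varies with [deg_y p] in a finite range, so the maximum of
    the corresponding constants is taken. *)
Lemma uniformity_bounded_genus (unif : uniformity_conjecture) (N : nat) :
  exists B : nat, forall g, (2 <= g <= N)%N ->
    forall (n : nat) (gs : seq {mpoly rat[n.+1]}),
      smooth_curve gs g -> at_most_rational_points gs B.
Proof.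
elim: N => [|N [B ubB]]; first by exists 0%N => g; lia.
have [lt_N|le_N] := ltnP N 1; first by exists 0%N => g; lia.
have [B' ubB'] := unif N.+1 le_N; exists (maxn B B') => g /andP[g_ge2 g_le].
move=> n gs gs_g ps ps0 ps_neq; rewrite leq_max; apply/orP.
move: g_le; rewrite leq_eqVlt => /orP[/eqP gE|g_le].
  by right; rewrite gE in gs_g; apply: (ubB' _ _ gs_g).
by left; apply: (ubB g _ _ _ gs_g) => //; rewrite g_ge2.
Qed.

Lemma hyperelliptic_uniform_bound (unif : uniformity_conjecture) (N : nat) :
  exists B : nat, forall (f : {poly rat}) (bs : seq rat),
    (5 < size f <= N)%N -> separable_poly f -> uniq bs ->
    (forall b, b \in bs -> exists w, w ^+ 2 = f.[b]) -> (size bs <= B)%N.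
Proof.
have [B ubB] := uniformity_bounded_genus unif N.
exists B => f bs /andP[size_f_gt size_f_le] sep_f uniq_bs sq_bs.
(* [size f] is the degree plus one, so [G] is half the degree rounded up; degree at least 5 gives
   genus [G - 1 >= 2]. *)
pose G := (size f)./2.
have G2 : (G.*2 <= size f <= G.*2.+1)%N.
  by rewrite /G; have := odd_double_half (size f); case: odd; lia.
have curve := hypell_smooth_curve (_ : (1 < G)%N) G2 sep_f.
apply: (hypell_points (G := G) (f := f)) => //; [lia|lia|].
by apply: (ubB G.-1); [lia|apply: curve; lia].
Qed.

(** * From incidences of tuples to a power bound *)

(** For [i < s <= x] one has [x <= s (x - i)]; the successor covers [x < s], where the falling
    factorial is 0. *)
Lemma leq_exp_ffact (x s : nat) : (x ^ s <= s ^ s * (x ^_ s).+1)%N.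
Proof.
have [lt_xs|le_sx] := ltnP x s.
  rewrite ffact_small // muln1; case: s lt_xs => // s lt_xs.
  by rewrite leq_exp2r // ltnW.
apply: leq_trans (leq_mul (leqnn _) (leqnSn _)).
have -> : (s ^ s * x ^_ s = \prod_(i < s) (s * (x - i)))%N.
  by rewrite big_split /= prod_nat_const card_ord ffact_prod.
have -> : (x ^ s = \prod_(i < s) x)%N by rewrite prod_nat_const card_ord.
by apply: leq_prod => i _; have := ltn_ord i; nia.
Qed.

Lemma fiber_bound (T U : eqType) (h : T -> U) (k : nat) (S : seq U) (Z : seq T) :
  (forall z, z \in Z -> h z \in S) ->
  (forall u, u \in S -> (count (fun z => h z == u) Z <= k)%N) ->
  (size Z <= k * size S)%N.
Proof.
elim: S Z => [|u S IHS] Z hZ kZ.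
  by case: Z hZ {kZ} => // z Z /(_ z); rewrite mem_head => /(_ isT).
rewrite -(count_predC (fun z => h z == u) Z) mulnS.
apply: leq_add; first by apply: kZ; rewrite mem_head.
rewrite -size_filter; apply: IHS => [z|v Sv].
  by rewrite mem_filter => /andP[/= neq_zu /hZ]; rewrite inE (negPf neq_zu).
rewrite count_filter; apply: leq_trans (kZ v _); last by rewrite inE Sv orbT.
by apply: sub_count => z /= /andP[].
Qed.

Lemma expr_superadditive (R : realFieldType) (u v : R) (s : nat) :
  0 <= u -> 0 <= v -> (0 < s)%N -> u ^+ s + v ^+ s <= (u + v) ^+ s.
Proof.
move=> u_ge0 v_ge0; case: s => // s _.
elim: s => [|s IHs] //; rewrite [leRHS]exprS.
apply: le_trans (ler_wpM2l (addr_ge0 u_ge0 v_ge0) IHs).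
rewrite !(exprS _ s.+1) mulrDr !mulrDl.
have uv : 0 <= u * v ^+ s.+1 by rewrite mulr_ge0 ?exprn_ge0.
have vu : 0 <= v * u ^+ s.+1 by rewrite mulr_ge0 ?exprn_ge0.
lra.
Qed.

Lemma le_add_powdiv (R : realFieldType) (x l : R) (s : nat) :
  0 <= x -> 0 < l -> x <= l + x ^+ s.+1 / l ^+ s.
Proof.
move=> x_ge0 l_gt0; have [le_xl|lt_lx] := lerP x l.
  by apply: ler_wpDr => //; rewrite divr_ge0 ?exprn_ge0 // ltW.
apply: ler_wpDl; first exact: ltW.
rewrite ler_pdivlMr ?exprn_gt0 // exprS ler_wpM2l // lerXn2r ?nnegrE // ltW //.
Qed.

(* Summing [x <= l + x ^ s / l ^ (s - 1)] over [B], with [l] chosen so that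
   [\sum_b x b ^ s <= n * l ^ s], gives [2 * n * l]. *)
Lemma power_mean_bound (R : realType) (I : Type) (B : seq I) (x : I -> nat)
    (s K a M : nat) (r : R := s%:R^-1) (n : R := (size B)%:R) :
  (0 < s)%N -> (0 < K)%N ->
  (\sum_(b <- B) x b ^_ s <= K * a ^ s + M * size B)%N ->
  (\sum_(b <- B) x b)%:R <=
    (2 * s)%:R * (K%:R * a%:R * n `^ (1 - r) + M%:R `^ r * n + n).
Proof.
move=> s_gt0 K_gt0 le_sum.
have [B0|B_gt0] := posnP (size B).
  rewrite (size0nil B0) big_nil mulr_ge0 // !addr_ge0 ?mulr_ge0 ?powR_ge0 //.
have n_gt0 : 0 < n by rewrite ltr0n.
have sr : s%:R * r = 1 by rewrite mulfV // pnatr_eq0 -lt0n.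
pose l : R := s%:R * (K%:R * a%:R * n `^ (- r) + M%:R `^ r + 1).
have l_gt0 : 0 < l.
  rewrite mulr_gt0 ?ltr0n // ltr_wpDl ?addr_ge0 ?mulr_ge0 ?powR_ge0 //.
have powE (y : R) : 0 <= y -> (y `^ r) ^+ s = y.
  by move=> y_ge0; rewrite -powR_mulrn ?powR_ge0 // -powRrM mulrC sr powRr1.
have nr : (n `^ (- r)) ^+ s = n^-1.
  by rewrite powRN exprVn powE // ltW.
have sum_le : \sum_(b <- B) (x b)%:R ^+ s <= n * l ^+ s :> R.
  apply: (@le_trans _ _ (s%:R ^+ s * (K%:R * a%:R ^+ s + M%:R * n + n))).
    have : (\sum_(b <- B) x b ^ s <= s ^ s * (K * a ^ s + M * size B + size B))%N.
      apply: (@leq_trans (\sum_(b <- B) s ^ s * (x b ^_ s).+1)).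
        by apply: leq_sum => b _; apply: leq_exp_ffact.
      rewrite -big_distrr leq_mul2l /=; apply/orP; right.
      under eq_bigr do rewrite -addn1.
      by rewrite big_split sum1_size leq_add2r.
    rewrite -(ler_nat R) natrM !natrD !natrM !natrX natr_sum.
    by under eq_bigr do rewrite natrX.
  rewrite exprMn mulrCA ler_wpM2l ?exprn_ge0 //.
  (* With [s ^ s] cancelled, superadditivity of powers leaves the three summands of [l] to be raised
     to the power [s] separately; [K <= K ^ s] since [K] is positive. *)
  apply: (@le_trans _ _ (n * ((K%:R * a%:R * n `^ (- r)) ^+ s
      + M%:R `^ r ^+ s + 1 ^+ s))).
    rewrite powE // expr1n !exprMn nr.
    have -> : n * (K%:R ^+ s * a%:R ^+ s * n^-1 + M%:R + 1) =
        K%:R ^+ s * a%:R ^+ s + M%:R * n + n.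
      by field; rewrite gt_eqF.
    rewrite !lerD2r ler_wpM2r ?exprn_ge0 // -natrX ler_nat.
    by rewrite -{1}(expn1 K) leq_pexp2l.
  rewrite ler_wpM2l //.
  apply: le_trans (expr_superadditive _ _ s_gt0) => //;
    rewrite ?addr_ge0 ?mulr_ge0 ?powR_ge0 //.
  by rewrite lerD2r; apply: expr_superadditive => //; rewrite ?mulr_ge0 ?powR_ge0.
have -> : (2 * s)%:R * (K%:R * a%:R * n `^ (1 - r) + M%:R `^ r * n + n) =
    n * l + n * l.
  have -> : n `^ (1 - r) = n * n `^ (- r).
    by rewrite powRD ?powRr1 // (gt_eqF n_gt0) implybT.
  by rewrite /l natrM; ring.
rewrite natr_sum; move: sum_le; rewrite -(prednK s_gt0) => sum_le.
apply: (@le_trans _ _ (\sum_(b <- B) (l + (x b)%:R ^+ s.-1.+1 / l ^+ s.-1))).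
  by apply: ler_sum => b _; apply: le_add_powdiv.
rewrite big_split /= big_const_seq count_predT iter_addr_0 -mulr_natl.
rewrite lerD2l -mulr_suml ler_pdivrMr ?exprn_gt0 //.
by rewrite -mulrA -exprS.
Qed.

(** * Degrees and substitutions *)

Lemma msize_mderiv (K : nzRingType) (n : nat) (F : {mpoly K[n]}) (i : 'I_n) :
  (msize F^`M(i) <= (msize F).-1)%N.
Proof.
rewrite msizeE; apply/bigmax_leqP_seq => m m_in _.
have : F@_(m + U_(i)) != 0.
  move: m_in; rewrite mcoeff_msupp mcoeff_deriv.
  by apply: contraNneq => ->; rewrite mul0rn.
rewrite -mcoeff_msupp => /msize_mdeg_lt; rewrite mdegD mdeg1 addn1.
by case: (msize F).
Qed.

Lemma mderiv_mwiden (K : comNzRingType) (n : nat) (p : {mpoly K[n]}) :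
  (mwiden p)^`M(ord_max) = 0.
Proof.
rewrite [p]mpolyE (raddf_sum (@mwiden n K)) (raddf_sum (mderiv ord_max)).
rewrite big1 //= => m _.
by rewrite mwidenZ mwidenX mderivZ mderivX mnmwiden_ordmax scale0r scaler0.
Qed.

Lemma mdeg_mnmwiden (n : nat) (m : 'X_{1..n}) : mdeg (mnmwiden m) = mdeg m.
Proof.
rewrite !mdegE big_ord_recr /= mnmwiden_ordmax addn0.
by apply: eq_bigr => i _; rewrite mnmwiden_widen.
Qed.

(* [F_z = 2 q q_z] bounds the degree of [q], hence that of [p]. *)
Lemma msize_of_square_sub (n : nat) (q F : {mpoly rat[n.+1]})
    (p : {mpoly rat[n]}) (d : nat) :
  F = q ^+ 2 - mwiden p -> msize F = d.+1 -> F^`M(ord_max) != 0 ->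
  (msize p <= d.*2.+1)%N.
Proof.
move=> FE sF Fz_neq0.
have FzE : F^`M(ord_max) = 2 *: (q^`M(ord_max) * q).
  by rewrite FE mderivB mderiv_mwiden subr0 expr2 mderivM scaler_nat mulr2n; ring.
have qqz_neq0 : q^`M(ord_max) * q != 0.
  by apply: contraNneq Fz_neq0 => E; rewrite FzE E scaler0.
have [qz_neq0 q_neq0] : q^`M(ord_max) != 0 /\ q != 0.
  by apply/andP; rewrite -negb_or -mulf_eq0.
have sq : (msize q <= d)%N.
  have := msize_mderiv F ord_max; rewrite FzE msizeZ // sF msizeM //.
  move: qz_neq0; rewrite -msize_poly_eq0 /=.
  case: (msize q^`M(ord_max)) => // k _; rewrite addSn.
  exact: leq_trans (leq_addl _ _).
have sp : (msize (mwiden p) <= d.*2.+1)%N.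
  have -> : mwiden p = q ^+ 2 - F by rewrite FE; ring.
  apply: leq_trans (msizeD_le _ _) _; rewrite msizeN sF expr2 msizeM //.
  by rewrite geq_max; move: sq; case: (msize q) => [|k]; lia.
rewrite msizeE; apply/bigmax_leqP_seq => m m_in _.
rewrite -mdeg_mnmwiden; apply: leq_trans sp; apply: msize_mdeg_lt.
by rewrite mcoeff_msupp mwiden_mnmwiden -mcoeff_msupp.
Qed.

Section Substitution.
Variables (p : {mpoly rat[2]}) (N : nat).
Hypothesis size_p : (msize p <= N)%N.

Let D := deg_y p.

Lemma at_xE a : at_x p a =
  \sum_(m <- msupp p) (p@_m * a ^+ m ord0) *: 'X^(m ord_max).
Proof.
apply: eq_bigr => m _; rewrite /mmap1 big_ord_recl big_ord_recl big_ord0 mulr1.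
rewrite !(tnth_nth 0) /= -polyC_exp mulrA -polyCM mul_polyC; congr (_ *: 'X^(m _)).
exact: val_inj.
Qed.

Lemma deg_y_le m : m \in msupp p -> (m ord_max <= D)%N.
Proof. by move=> m_in; apply: leq_bigmax_seq. Qed.

Lemma size_at_x_le a : (size (at_x p a) <= D.+1)%N.
Proof.
rewrite at_xE; apply: leq_trans (size_sum _ _ _) _.
apply/bigmax_leqP_seq => m m_in _; apply: leq_trans (size_scale_leq _ _) _.
by rewrite size_polyXn ltnS deg_y_le.
Qed.

(** The leading coefficient of [p] in [y], as a polynomial in [x]: its roots are the [a] at which
    the degree of [p(a, y)] drops. *)
Definition lead_y : {poly rat} :=
  \sum_(m <- msupp p | m ord_max == D) p@_m *: 'X^(m ord0).

Lemma coef_at_x_lead a : (at_x p a)`_D = lead_y.[a].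
Proof.
rewrite at_xE coef_sum horner_sum [RHS]big_mkcond; apply: eq_bigr => m _.
rewrite coefZ coefXn eq_sym; case: eqP => _; last by rewrite mulr0.
by rewrite mulr1 hornerZ hornerXn.
Qed.

Lemma lead_y_neq0 : p != 0 -> lead_y != 0.
Proof.
move=> p_neq0.
have [m m_in mD] : exists2 m, m \in msupp p & m ord_max = D.
  have : (0 < size (msupp p))%N by rewrite lt0n size_eq0 msupp_eq0.
  rewrite /D /deg_y; elim: (msupp p) => // m [|m' s] IHs _.
    by exists m; rewrite ?mem_head // big_seq1.
  have [m1 m1_in m1E] := IHs isT; rewrite big_cons.
  case: (leqP (\max_(j <- m' :: s) j ord_max) (m ord_max)) => lt_m.
    by exists m; rewrite ?mem_head //; apply/esym/maxn_idPl.
  by exists m1; rewrite // inE m1_in orbT.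
apply/eqP => /(congr1 (fun r : {poly rat} => r`_(m ord0))).
rewrite coef0 coef_sum big_mkcond (bigD1_seq m) ?msupp_uniq //= mD eqxx.
rewrite coefZ coefXn eqxx mulr1 big1 ?addr0; last first.
  move=> m' neq_m; case: eqP => // m'D; rewrite coefZ coefXn.
  case: eqP => [E|_]; last by rewrite mulr0.
  case/eqP: neq_m; apply/mnmP => i; case: i => -[|[|//]] lt_i.
    by rewrite (_ : Ordinal lt_i = ord0); [rewrite E|apply: val_inj].
  by rewrite (_ : Ordinal lt_i = ord_max); [rewrite m'D mD|apply: val_inj].
by move/eqP; rewrite mcoeff_eq0 m_in.
Qed.

Lemma size_lead_y : (size lead_y <= N)%N.
Proof.
apply: leq_trans (size_sum _ _ _) _; apply/bigmax_leqP_seq => m m_in _.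
apply: leq_trans (size_scale_leq _ _) _; rewrite size_polyXn.
apply: leq_trans (leq_trans (msize_mdeg_lt m_in) size_p).
by rewrite ltnS mdegE (bigD1 ord0) //= leq_addr.
Qed.

Lemma size_at_x a : ~~ root lead_y a -> size (at_x p a) = D.+1.
Proof.
rewrite /root -coef_at_x_lead => cD; apply/eqP; rewrite eqn_leq size_at_x_le.
by rewrite ltnNge; apply: contra cD => le_D; rewrite nth_default.
Qed.

Lemma count_degenerate (s : seq rat) : p != 0 -> uniq s ->
  (count (fun a => root lead_y a) s <= N)%N.
Proof.
move=> p_neq0 uniq_s; rewrite -size_filter.
apply: leq_trans size_lead_y; apply: ltnW; apply: max_poly_roots.
- exact: lead_y_neq0.
- by apply/allP => a; rewrite mem_filter => /andP[].
- exact: filter_uniq.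
Qed.

Lemma at_xy_mwiden a b : at_xy (mwiden p) a b = ((at_x p a).[b])%:P.
Proof.
have -> : mwiden p = \sum_(m <- msupp p) p@_m *: 'X_[mnmwiden m].
  rewrite {1}[p]mpolyE (raddf_sum (@mwiden 2 rat)); apply: eq_bigr => m _.
  by rewrite /= mwidenZ mwidenX.
rewrite at_xE horner_sum rmorph_sum /at_xy /subst_poly (raddf_sum (mmap _ _)).
apply: eq_bigr => m _ /=; rewrite mmapZ mmapX /mmap1.
rewrite big_ord_recr /= mnmwiden_ordmax expr0 mulr1 hornerZ hornerXn.
rewrite big_ord_recl big_ord_recl big_ord0 mulr1 !mnmwiden_widen !(tnth_nth 0) /=.
rewrite -!polyC_exp -!polyCM mulrA; congr (_ * b ^+ m _)%:P.
exact: val_inj.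
Qed.

End Substitution.

Lemma at_xy_square_sub (q : {mpoly rat[3]}) (p : {mpoly rat[2]}) a b :
  at_xy (q ^+ 2 - mwiden p) a b = at_xy q a b ^+ 2 - ((at_x p a).[b])%:P.
Proof. by rewrite -at_xy_mwiden /at_xy /subst_poly rmorphB rmorphXn. Qed.

(** The coordinates are rational, so the real value of [F] is the image of a rational one under the
    injective [ratr]. *)
Lemma zero_setE (R : realType) (F : {mpoly rat[3]}) (a b c : rat) :
  ([tuple ratr a; ratr b; ratr c] \in @zero_set R _ F) = root (at_xy F a b) c.
Proof.
have E : (map_mpoly (ratr : rat -> R) F).@[tnth [tuple ratr a; ratr b; ratr c]]
    = ratr (at_xy F a b).[c].
  rewrite /at_xy /subst_poly [F]mpolyE (raddf_sum (map_mpoly _)).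
  rewrite (raddf_sum (meval _)) (raddf_sum (mmap _ _)) horner_sum rmorph_sum.
  apply: eq_bigr => m _ /=; rewrite map_mpolyZ map_mpolyX mevalZ mevalX mmapZ mmapX.
  rewrite hornerM hornerC rmorphM /mmap1; congr (_ * _).
  rewrite horner_prod rmorph_prod; apply: eq_bigr => i _.
  rewrite horner_exp rmorphXn; congr (_ ^+ _); rewrite !(tnth_nth 0).
  by case: i => -[|[|[|//]]] ? /=; rewrite ?hornerC ?hornerX.
apply/idP/idP => [|/rootP F0]; first rewrite inE /zero_set /= E => /eqP.
  by rewrite fmorph_eq0.
by rewrite inE /zero_set /= E F0 rmorph0.
Qed.

Lemma size_at_xy (F : {mpoly rat[3]}) a b : (size (at_xy F a b) <= msize F)%N.
Proof.
apply: leq_trans (size_sum _ _ _) _; apply/bigmax_leqP_seq => m m_in _.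
rewrite mul_polyC; apply: leq_trans (size_scale_leq _ _) _.
rewrite /mmap1 !big_ord_recl big_ord0 !(tnth_nth 0) /= mulr1 -!polyC_exp.
rewrite mul_polyC; apply: leq_trans (size_scale_leq _ _) _.
rewrite mul_polyC; apply: leq_trans (size_scale_leq _ _) _.
rewrite size_polyXn; apply: leq_trans (msize_mdeg_lt m_in).
by rewrite ltnS mdegE !big_ord_recl big_ord0 addn0; lia.
Qed.

(** * Double counting *)

(** The gcd of [f] and [f'] commutes with base change; if it is not a nonzero constant, it has a
    root in the algebraically closed field [R[i]], a double root of [f]. *)
Lemma separable_of_no_repeated_roots (R : realType) (f : {poly rat}) :
  no_repeated_roots R f -> separable_poly f.
Proof.
move=> nrr; rewrite unlock; apply/negPn/negP => ncop.
pose h : {rmorphism rat -> R[i]} := ratr.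
have /closed_rootP[z] : size (map_poly h (gcdp f f^`())) != 1%N.
  by rewrite size_map_poly.
rewrite gcdp_map root_gcd -deriv_map => /andP[/factor_theorem[g fE] f'z].
have := nrr z; rewrite -[ratr]/(h : _ -> _) fE expr2 dvdp_mul2r ?polyXsubC_eq0 //.
rewrite dvdp_XsubCl => /negP; apply; move: f'z.
by rewrite fE derivM derivXsubC mulr1 /root !hornerE subrr mulr0 add0r.
Qed.

Lemma coprimep_of_no_common_root (R : realType) (f g : {poly rat}) :
  ~ common_root R f g -> coprimep f g.
Proof.
move=> ncr; apply/negPn/negP => ncop; apply: ncr.
pose h : {rmorphism rat -> R[i]} := ratr.
have /closed_rootP[z] : size (map_poly h (gcdp f g)) != 1%N.
  by rewrite size_map_poly.
rewrite gcdp_map root_gcd => /andP[fz gz]; exists z.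
split; [exact: fz|exact: gz].
Qed.

Lemma separable_prod (K : fieldType) (I : eqType) (s : seq I) (F : I -> {poly K}) :
  uniq s -> (forall i, i \in s -> separable_poly (F i)) ->
  (forall i j, i \in s -> j \in s -> i != j -> coprimep (F i) (F j)) ->
  separable_poly (\prod_(i <- s) F i).
Proof.
elim: s => [|i s IHs]; first by rewrite big_nil unlock coprime1p.
case/andP=> i_notin uniq_s sepF copF; rewrite big_cons separable_mul.
apply/and3P; split; first by apply: sepF; rewrite mem_head.
  apply: IHs => // [j s_j|j k s_j s_k]; first by apply: sepF; rewrite inE s_j orbT.
  by apply: copF; rewrite inE ?s_j ?s_k orbT.
rewrite big_seq; apply: (big_ind (coprimep (F i))) => [||j s_j].
- exact: coprimep1.
- by move=> u v cu cv; rewrite coprimepMr cu.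
- apply: copF; rewrite ?mem_head // ?inE ?s_j ?orbT //.
  by apply: contraNneq i_notin => ->.
Qed.

Definition is_square (x : rat) : bool := `[< exists w : rat, w ^+ 2 = x >].

Lemma is_squareP x : reflect (exists w : rat, w ^+ 2 = x) (is_square x).
Proof. exact: asboolP. Qed.

Lemma is_square_prod (I : Type) (s : seq I) (F : I -> rat) :
  all (fun i => is_square (F i)) s -> exists w, w ^+ 2 = \prod_(i <- s) F i.
Proof.
elim: s => [|i s IHs]; first by exists 1; rewrite big_nil expr1n.
case/andP=> /is_squareP[w Ew] /IHs[w' Ew'].
by exists (w * w'); rewrite big_cons exprMn Ew Ew'.
Qed.

Section DoubleCounting.
Variables (R : realType) (N s K : nat).
Variables (p : {mpoly rat[2]}) (A B : {fset rat}).
Hypothesis K_bound : forall (f : {poly rat}) (bs : seq rat),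
  (5 < size f <= N)%N -> separable_poly f -> uniq bs ->
  (forall b, b \in bs -> exists w, w ^+ 2 = f.[b]) -> (size bs <= K)%N.
Hypotheses (sD_ge : (5 <= s * deg_y p)%N) (sD_le : (s * deg_y p < N)%N).
Hypothesis sepA : forall a, a \in A -> no_repeated_roots R (at_x p a).

(** Only those [a] where [p(a, y)] has full degree are kept, so that the product over an [s]-tuple
    has degree exactly [s * deg_y p]. *)
Definition fiber (b : rat) : {set A} :=
  [set a : A | ~~ root (lead_y p) (val a) & is_square (at_x p (val a)).[b]].

(* The [b] counted here are abscissas of rational points on the hyperelliptic
   curve [w ^ 2 = \prod_(a <- t) p(a, y)]. *)
Lemma good_tuple_bound (t : s.-tuple A) : t \notin bad_tuples R A p s ->
  (count (fun b => all (mem (fiber b)) t && uniq t) (enum_fset B) <= K)%N.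
Proof.
move=> t_good; rewrite -size_filter; set bs := filter _ _.
have bsP b : b \in bs -> all (mem (fiber b)) t && uniq t.
  by rewrite mem_filter => /andP[].
have uniq_bs : uniq bs by rewrite filter_uniq // fset_uniq.
case bsE : bs => [//|b0 bs']; rewrite -bsE.
have /andP[/allP t_fib uniq_t] : all (mem (fiber b0)) t && uniq t.
  by apply: bsP; rewrite bsE mem_head.
pose f := \prod_(a <- t) at_x p (val a).
have f_sq b : b \in bs -> exists w, w ^+ 2 = f.[b].
  move=> /bsP/andP[/allP t_b _]; rewrite /f horner_prod; apply: is_square_prod.
  by apply/allP => a /t_b /=; rewrite inE => /andP[].
have t_size a : a \in t -> size (at_x p (val a)) = (deg_y p).+1.
  by move=> /t_fib /=; rewrite inE => /andP[lead_a _]; apply: size_at_x.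
have D_gt0 : (0 < deg_y p)%N by move: sD_ge; case: (deg_y p); rewrite ?muln0.
have size_f : size f = (s * deg_y p).+1.
  rewrite /f size_prod_seq => [|a /t_size sa]; last by rewrite -size_poly_gt0 sa.
  rewrite big_seq (eq_bigr _ t_size) -big_seq big_const_seq count_predT iter_addn_0.
  by rewrite size_tuple; lia.
apply: (K_bound (f := f)) => //; first by rewrite size_f ltnS sD_ge.
apply: separable_prod => // [a _|a a' t_a t_a' neq_a].
  by apply: (@separable_of_no_repeated_roots R); apply: sepA; apply: valP.
apply: (@coprimep_of_no_common_root R) => cr.
move: t_good; rewrite inE uniq_t /= => /asboolP; apply.
have lt_i : (index a t < s)%N by rewrite -[X in (_ < X)%N](size_tuple t) index_mem.
have lt_j : (index a' t < s)%N by rewrite -[X in (_ < X)%N](size_tuple t) index_mem.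
exists (Ordinal lt_i), (Ordinal lt_j); split.
  apply: contraNneq neq_a => /(congr1 val) /= E.
  by rewrite -(nth_index a t_a) E nth_index.
by rewrite !(tnth_nth a) /= !nth_index.
Qed.

(** The falling factorial counts the [s]-tuples of distinct elements of the fibre. After exchanging
    the sums, a good tuple is hit by at most [K] values of [b], a bad one trivially by at most
    [|B|]. *)
Lemma sum_ffact_fiber :
  (\sum_(b <- enum_fset B) #|fiber b| ^_ s <=
    K * #|` A| ^ s + #|bad_tuples R A p s| * size (enum_fset B))%N.
Proof.
pose hit b (t : s.-tuple A) := all (mem (fiber b)) t && uniq t.
have E b : (#|fiber b| ^_ s = \sum_(t : s.-tuple A) hit b t)%N.
  by rewrite -card_uniq_tuples -sum1dep_card big_mkcond.
under eq_bigr do rewrite E.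
rewrite exchange_big /=.
rewrite (bigID (mem (bad_tuples R A p s))) /= addnC; apply: leq_add.
  apply: (@leq_trans (\sum_(t : s.-tuple A) K)); last first.
    by rewrite sum_nat_const card_tuple -cardfE mulnC.
  rewrite big_mkcond; apply: leq_sum => t _; case: ifP => // t_good.
  apply: leq_trans (good_tuple_bound t_good).
  by rewrite -sum1_count [leqRHS]big_mkcond.
rewrite -sum_nat_const; apply: leq_sum => t _.
rewrite -(count_predT (enum_fset B)) -sum1_count.
by apply: leq_sum => b _; case: (hit b t).
Qed.

End DoubleCounting.

Lemma deg_y_lt_msize (p : {mpoly rat[2]}) : p != 0 -> (deg_y p < msize p)%N.
Proof.
rewrite -msize_poly_eq0 -lt0n => sp_gt0.
rewrite -(prednK sp_gt0) ltnS; apply/bigmax_leqP_seq => m m_in _.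
rewrite -ltnS (prednK sp_gt0); apply: leq_trans (msize_mdeg_lt m_in).
by rewrite ltnS mdegE (bigD1 ord_max) //= leq_addr.
Qed.

Definition square_pairs (p : {mpoly rat[2]}) (A B : {fset rat}) : seq (rat * rat) :=
  [seq ab <- [seq (a, b) | a <- enum_fset A, b <- enum_fset B]
     | is_square (at_x p ab.1).[ab.2]].

(** Off the vertical pairs [F(a, b, z)] is a nonzero polynomial of degree at most [d], and a zero
    [c] exhibits [p(a, b)] as the square of [q(a, b, c)]; over a vertical pair every [c] in [C] may
    occur. *)
Lemma card_zeros_on_grid (R : realType) (q F : {mpoly rat[3]}) (p : {mpoly rat[2]})
    (A B C : {fset rat}) (d : nat) :
  F = q ^+ 2 - mwiden p -> msize F = d.+1 ->
  (#|` zeros_on_grid R A B C F| <=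
    d * size (square_pairs p A B) + #|` C| * #|` vertical_pairs A B F|)%N.
Proof.
move=> FE sF; set Z := enum_fset (zeros_on_grid R A B C F).
have ZP z : z \in Z ->
    [/\ z.1.1 \in A, z.1.2 \in B, z.2 \in C & root (at_xy F z.1.1 z.1.2) z.2].
  rewrite /Z /zeros_on_grid; rewrite !inE /= zero_setE.
  by case/andP=> /andP[/andP[-> ->] ->] ->.
have uniq_Z : uniq Z by apply: fset_uniq.
pose v (z : rat * rat * rat) := at_xy F z.1.1 z.1.2 == 0.
have snd_uniq (P : pred (rat * rat * rat)) u :
    uniq [seq z.2 | z <- [seq z <- Z | P z] & z.1 == u].
  rewrite map_inj_in_uniq ?filter_uniq // => -[z1 z2] [z1' z2'].
  by rewrite !mem_filter /= => /andP[/eqP-> _] /andP[/eqP-> _] ->.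
rewrite -(count_predC v Z : _ = #|` zeros_on_grid R A B C F|) addnC -!size_filter.
apply: leq_add; apply: (fiber_bound (h := fst)) => [z|u _].
- rewrite mem_filter /= => /andP[_ /ZP[zA zB _ z0]]; rewrite mem_filter.
  apply/andP; split; last by rewrite [z.1]surjective_pairing; apply: allpairs_f.
  apply/is_squareP; exists (at_xy q z.1.1 z.1.2).[z.2].
  apply/eqP; rewrite -subr_eq0; apply/eqP; move/rootP: z0.
  by rewrite FE at_xy_square_sub hornerD hornerN hornerC horner_exp.
- rewrite -size_filter -(size_map snd).
  case zE: [seq z <- [seq z <- Z | predC v z] | z.1 == u] => [//|z0 zs]; rewrite -zE.
  have u_neq0 : at_xy F u.1 u.2 != 0.
    have := mem_head z0 zs; rewrite -zE !mem_filter /= => /andP[/eqP<- /andP[]] //.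
  rewrite -ltnS -sF; apply: leq_trans (size_at_xy F u.1 u.2).
  apply: max_poly_roots => //; apply/allP => _ /mapP[z + ->].
  by rewrite !mem_filter => /andP[/eqP<- /andP[_ /ZP[]]].
- rewrite mem_filter /= => /andP[vz /ZP[zA zB _ _]].
  by rewrite /vertical_pairs !inE /= zA zB.
- rewrite -size_filter -(size_map snd); apply: uniq_leq_size => // _ /mapP[z + ->].
  by rewrite !mem_filter => /andP[_ /andP[_ /ZP[]]].
Qed.

Lemma sum_bool_count (T : Type) (P : pred T) (t : seq T) :
  (\sum_(x <- t) P x = count P t)%N.
Proof. by rewrite -sum1_count [RHS]big_mkcond. Qed.

(** For each [b], the term [N] pays for the values of [a] with a degree drop, which [fiber] leaves
    out. *)
Lemma size_square_pairs (p : {mpoly rat[2]}) (A B : {fset rat}) (N : nat) :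
  p != 0 -> (msize p <= N)%N ->
  (size (square_pairs p A B) <=
    N * size (enum_fset B) + \sum_(b <- enum_fset B) #|fiber p A b|)%N.
Proof.
move=> p_neq0 size_p; rewrite size_filter -sum1_count big_mkcond big_allpairs_dep.
rewrite exchange_big /=.
apply: (@leq_trans (\sum_(b <- enum_fset B) (N + #|fiber p A b|))); last first.
  by rewrite big_split /= big_const_seq count_predT iter_addn_0.
apply: leq_sum => b _.
apply: (@leq_trans (\sum_(a <- enum_fset A) (root (lead_y p) a
    + (~~ root (lead_y p) a && is_square (at_x p a).[b])))).
  by apply: leq_sum => a _ /=; case: is_square; case: root.
rewrite big_split leq_add //=.
  rewrite sum_bool_count; apply: leq_trans (count_degenerate size_p p_neq0 _) _ => //.
  exact: fset_uniq.
by rewrite big_seq_fsetE /fiber -sum1dep_card [leqRHS]big_mkcond.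
Qed.

(** * The bound for the zero set on a grid *)

Theorem theorem2p1 (R : realType) (unif : uniformity_conjecture) (s d : nat) :
  exists2 c : R, 0 < c &
    forall (q : {mpoly rat[3]}) (p : {mpoly rat[2]}) (F : {mpoly rat[3]})
      (A B C : {fset rat}),
      F = q ^+ 2 - mwiden p ->
      msize F = d.+1 ->
      F^`M(ord_max) != 0 ->
      (1 <= deg_y p)%N ->
      (5 <= s * deg_y p)%N ->
      (forall t : nat, (5 <= t * deg_y p)%N -> (s <= t)%N) ->
      (forall a, a \in A -> no_repeated_roots R (at_x p a)) ->
      let nA : R := #|` A|%:R in
      let nB : R := #|` B|%:R in
      let nC : R := #|` C|%:R in
      let M : R := #|bad_tuples R A p s|%:R in
      let L : R := #|` vertical_pairs A B F|%:R in
      let r : R := s%:R^-1 in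
      #|` zeros_on_grid R A B C F|%:R <=
        c * (nA * nB `^ (1 - r) + nA `^ (1 - r) * nB + M `^ r * nB + L * nC).
Proof.
(* Since [deg_y p] is at most [2 d], this size bound covers all products over [s]-tuples and depends
   on [s] and [d] only. *)
have [K0 K0_bound] := hyperelliptic_uniform_bound unif (s * d.*2).+2.
(* [power_mean_bound] asks for a positive constant. *)
pose K := K0.+1.
(* [al] pays for the degenerate values of [a], [be] and [ga] for the power mean bound, all with the
   factor [d] for the zeros over one pair; the added 1 pays for the vertical pairs. *)
pose al : R := (d * d.*2.+1)%:R; pose be : R := (d * (2 * s))%:R.
pose ga : R := (d * (2 * s) * K)%:R.
exists (al + be + ga + 1); first by rewrite ltr_wpDl // !addr_ge0.
move=> q p F A B C FE sF Fz_neq0 D_gt0 sD_ge s_min sepA /=.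
have s_gt0 : (0 < s)%N by case: (s) sD_ge.
have p_neq0 : p != 0.
  by apply: contraTneq D_gt0 => ->; rewrite /deg_y msupp0 big_nil.
have size_p := msize_of_square_sub FE sF Fz_neq0.
have sD_le : (s * deg_y p < (s * d.*2).+2)%N.
  rewrite ltnS; apply: leqW; rewrite leq_mul2l -ltnS.
  by rewrite (leq_trans (deg_y_lt_msize p_neq0) size_p) orbT.
set r : R := s%:R^-1; set n : R := #|` B|%:R; set M : R := #|bad_tuples R A p s|%:R.
set L : R := #|` vertical_pairs A B F|%:R; set a : R := #|` A|%:R; set m : R := #|` C|%:R.
(* An empty [A] is treated apart, because [n_le] relies on [|A| >= 1]. *)
have [A0|A_gt0] := posnP #|` A|.
  have -> : zeros_on_grid R A B C F = fset0.
    apply/fsetP => z; rewrite !inE /=; apply/negP => /andP[/andP[/andP[zA _] _] _].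
    by move/cardfs0_eq: A0 zA => ->; rewrite inE.
  by rewrite cardfs0 mulr_ge0 // !addr_ge0 // mulr_ge0 ?powR_ge0.
have K_bound (f : {poly rat}) (bs : seq rat) : (5 < size f <= (s * d.*2).+2)%N ->
    separable_poly f -> uniq bs ->
    (forall b, b \in bs -> exists w, w ^+ 2 = f.[b]) -> (size bs <= K)%N.
  by move=> sf sepf ubs sqbs; apply: leqW; apply: K0_bound sqbs.
have sum_le := sum_ffact_fiber B K_bound sD_ge sD_le sepA.
have := power_mean_bound R s_gt0 (ltn0Sn K0) sum_le.
rewrite -/r -/n -/M -/a; set X : R := (\sum_(b <- _) _)%:R => X_le.
have Z_le : #|` zeros_on_grid R A B C F|%:R <= d%:R * (d.*2.+1%:R * n + X) + m * L.
  rewrite /n /X /m /L -!(natrM, natrD) ler_nat.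
  apply: leq_trans (card_zeros_on_grid R A B C FE sF) _.
  by rewrite leq_add2r leq_mul2l size_square_pairs ?orbT.
(* This absorbs the terms linear in [|B|] into the second summand of the bound. *)
have n_le : n <= a `^ (1 - r) * n.
  rewrite ler_peMl // -[leLHS](powRr0 a) ler_powR ?ler1n // subr_ge0 /r.
  by rewrite invf_le1 ?ler1n ?ltr0n.
apply: le_trans Z_le _.
have x1_ge0 : 0 <= a * n `^ (1 - r) by rewrite mulr_ge0 ?powR_ge0.
have x3_ge0 : 0 <= M `^ r * n by rewrite mulr_ge0 ?powR_ge0.
have x4_ge0 : 0 <= L * m by rewrite mulr_ge0.
have n_ge0 : 0 <= n by [].
have [al_ge0 be_ge0 ga_ge0] : [/\ 0 <= al, 0 <= be & 0 <= ga] by [].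
have : d%:R * X <= ga * (a * n `^ (1 - r)) + be * (M `^ r * n) + be * n.
  have -> : ga * (a * n `^ (1 - r)) + be * (M `^ r * n) + be * n =
      d%:R * ((2 * s)%:R * (K%:R * a * n `^ (1 - r) + M `^ r * n + n)).
    by rewrite /ga /be !natrM; ring.
  exact: ler_wpM2l.
have -> : d%:R * (d.*2.+1%:R * n + X) = al * n + d%:R * X.
  by rewrite /al natrM; ring.
move: (a * _) x1_ge0 (a `^ _ * n) n_le (M `^ r * n) x3_ge0 => x1 x1_ge0 x2 n_le x3 x3_ge0.
rewrite [m * L]mulrC; move: (L * m) x4_ge0 => x4 x4_ge0 dX_le.
have h1 := mulr_ge0 al_ge0 x1_ge0; have h2 := mulr_ge0 al_ge0 x3_ge0.
have h3 := mulr_ge0 al_ge0 x4_ge0; have h4 := mulr_ge0 be_ge0 x1_ge0.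
have h5 := mulr_ge0 be_ge0 x4_ge0; have x2_ge0 := le_trans n_ge0 n_le.
have h6 := mulr_ge0 ga_ge0 x2_ge0; have h7 := mulr_ge0 ga_ge0 x3_ge0.
have h8 := mulr_ge0 ga_ge0 x4_ge0.
have h9 := ler_wpM2l al_ge0 n_le; have h10 := ler_wpM2l be_ge0 n_le.
lra.
Qed.
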